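(* Let $\mathcal G^{FE},\mathcal K^{FE}$ be the finite-element discrete gradient and curl matrices and let $\widetilde{\mathcal M_p},\widetilde{\mathcal M_{\boldsymbol E}},\widetilde{\mathcal M_{\boldsymbol B}}$ be the mass-lumped mass matrices defined in the context. Let $$\widetilde{\mathcal A}_{\mathrm{FE}}=\begin{bmatrix}\frac2\tau\widetilde{\mathcal M_{\boldsymbol B}} & \widetilde{\mathcal M_{\boldsymbol B}}\mathcal K^{FE} & 0\\ -(\mathcal K^{FE})^T\widetilde{\mathcal M_{\boldsymbol B}} & \frac2\tau\widetilde{\mathcal M_{\boldsymbol E}} & \widetilde{\mathcal M_{\boldsymbol E}}\mathcal G^{FE}\\ 0 & -(\mathcal G^{FE})^T\widetilde{\mathcal M_{\boldsymbol E}} & \frac2\tau\widetilde{\mathcal M_p}\end{bmatrix}$$ be the matrix of the mass-lumped mixed finite-element Crank--Nicolson discretization of Maxwell's equations with time step $\tau>0$, let $$\mathcal A_{\mathrm{SFE}}=\begin{bmatrix}\mathcal D_{\partial D}^{-1}\mathcal D_{\boldsymbol e^V}^{-1} & & \\ & \mathcal D_{\partial V}^{-1}\mathcal D_{\boldsymbol e^D}^{-1} & \\ & & \mathcal D_V^{-1}\end{bmatrix}\widetilde{\mathcal A}_{\mathrm{FE}}$$ be its left-scaled version, and let $$\mathcal A_{\mathrm{MFD}}=\begin{bmatrix}\frac2\tau\mathcal I_{\boldsymbol e^V} & \mathcal D_{\partial D}^{-1}\mathcal K\mathcal D_{\boldsymbol e^D} & 0\\ -\mathcal D_{\partial V}^{-1}\mathcal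 K^T\mathcal D_{\boldsymbol e^V} & \frac2\tau\mathcal I_{\boldsymbol e^D} & \mathcal D_{\boldsymbol e^D}^{-1}\mathcal G\\ 0 & -\mathcal D_V^{-1}\mathcal G^T\mathcal D_{\partial V} & \frac2\tau\mathcal I_V\end{bmatrix}$$ be the matrix of the mimetic finite-difference (MFD) Crank--Nicolson discretization. Then $$\mathcal A_{\mathrm{SFE}}=\mathcal A_{\mathrm{MFD}}.$$
   Context: Mesh. $\Omega\subset\mathbb R^3$ is a bounded connected polyhedral domain with a Delaunay triangulation into tetrahedra $D_k$, $k=1,\dots,N_V$, with vertices $\boldsymbol x_i^D$, $i=1,\dots,N_D$, such that the circumcenter $\boldsymbol x_k^V$ of each $D_k$ lies in the interior of $D_k$. The dual Voronoi mesh has nodes $\boldsymbol x_k^V$ and cells $V_i=\{\boldsymbol x\in\Omega: |\boldsymbol x-\boldsymbol x_i^D|\le|\boldsymbol x-\boldsymbol x_j^D|\ \forall j\ne i\}$. Delaunay edges are $\boldsymbol e_{ij}^D$ (joining $\boldsymbol x_i^D,\boldsymbol x_j^D$, with unit tangent from lower to higher index); Delaunay faces are $\partial D_{km}=\partial D_k\cap\partial D_m$; Voronoi edges $\boldsymbol e_{km}^V$ join $\boldsymbol x_k^V,\boldsymbol x_m^V$ and are orthogonal to $\partial D_{km}$; the Voronoi face $\partial V_{ij}$ is the common face of $V_i$ and $V_j$ and is orthogonal to $\boldsymbol e_{ij}^D$. So Delaunay vertices correspond to Voronoi cells, Delaunay edges to Voronoi faces, Delaunay faces to Voronoi edges. $|\cdot|$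 denotes length, area or volume. All matrices are indexed by the Delaunay vertices, edges and faces that carry degrees of freedom (those not on $\partial\Omega$, by the homogeneous essential boundary conditions). Matrices. $\mathcal G$ is the signed edge-vertex incidence matrix and $\mathcal K$ the signed face-edge incidence matrix of the Delaunay mesh (entries $0,\pm1$, consistent with fixed orientations of edges and faces). The diagonal matrices are $\mathcal D_{\boldsymbol e^D}=\mathrm{diag}(|\boldsymbol e_{ij}^D|)$, $\mathcal D_{\partial D}=\mathrm{diag}(|\partial D_{km}|)$, $\mathcal D_{\boldsymbol e^V}=\mathrm{diag}(|\boldsymbol e_{km}^V|)$, $\mathcal D_{\partial V}=\mathrm{diag}(|\partial V_{ij}|)$, $\mathcal D_V=\mathrm{diag}(|V_i|)$. $\mathcal I_{\boldsymbol e^V},\mathcal I_{\boldsymbol e^D},\mathcal I_V$ are identity matrices indexed by Voronoi edges, Delaunay edges, Voronoi cells. Finite elements. On the Delaunay mesh, $H_{h,0}(\mathrm{grad})$, $\boldsymbol H_{h,0}(\mathrm{curl})$, $\boldsymbol H_{h,0}(\mathrm{div})$ are the lowest-order Lagrange, Nédélec, and Raviart--Thomas spaces with homogeneous essential boundary conditions, with bases $\phi_i^{\mathrm{grad}},\boldsymbol\phi_i^{\mathrm{curl}},\boldsymbol\phi_i^{\mathrm{div}}$ dual to the degrees of freedom: vertex values; $\boldsymbol\eta_i^{\mathrm{curl}}(\boldsymbol u)=\frac1{|e_i|}\int_{e_i}\boldsymbol u\cdot\boldsymbol t_i\,ds$ for edges $e_i$ with unit tangent $\boldsymbol t_i$;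 $\boldsymbol\eta_i^{\mathrm{div}}(\boldsymbol u)=\frac1{|f_i|}\int_{f_i}\boldsymbol u\cdot\boldsymbol n_i\,dS$ for faces $f_i$ with unit normal $\boldsymbol n_i$. Define $\mathcal G^{FE}_{ij}=\boldsymbol\eta_i^{\mathrm{curl}}(\nabla\phi_j^{\mathrm{grad}})$ and $\mathcal K^{FE}_{ij}=\boldsymbol\eta_i^{\mathrm{div}}(\nabla\times\boldsymbol\phi_j^{\mathrm{curl}})$. Mass lumping. The lumped mass matrices are the Gram matrices of the respective bases for the following quadrature-based inner products (sums over tetrahedra $D_l$ and over the vertices, edges, or faces of $D_l$): $\langle u,v\rangle_{\widetilde{\mathcal M}_p}=\sum_l\sum_{\boldsymbol x_i^D\in D_l}|D_l\cap V_i|\,u(\boldsymbol x_i^D)v(\boldsymbol x_i^D)$; $\langle\boldsymbol u,\boldsymbol v\rangle_{\widetilde{\mathcal M}_{\boldsymbol E}}=\sum_l\sum_{\boldsymbol e_{mn}^D\subset D_l}|\partial V_{mn}\cap D_l|\,|\boldsymbol e_{mn}^D|\,\big(\tfrac1{|\boldsymbol e_{mn}^D|}\int_{\boldsymbol e_{mn}^D}\boldsymbol u\cdot\boldsymbol t\,ds\big)\big(\tfrac1{|\boldsymbol e_{mn}^D|}\int_{\boldsymbol e_{mn}^D}\boldsymbol v\cdot\boldsymbol t\,ds\big)$; $\langle\boldsymbol u,\boldsymbol v\rangle_{\widetilde{\mathcal M}_{\boldsymbol B}}=\sum_l\sum_{\partial D_{lm}\subset\partial D_l}|\boldsymbol e_{lm}^V\cap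 D_l|\,|\partial D_{lm}|\,\big(\tfrac1{|\partial D_{lm}|}\int_{\partial D_{lm}}\boldsymbol u\cdot\boldsymbol n\,dS\big)\big(\tfrac1{|\partial D_{lm}|}\int_{\partial D_{lm}}\boldsymbol v\cdot\boldsymbol n\,dS\big)$.
   Formalization: The formal theorem also assumes that each Voronoi edge joining two neighbouring circumcenters meets the shared Delaunay face; interior circumcenters alone do not ensure this, and without it the equality of the (1,1) blocks fails. *)

(* Defs.v *)
From HB Require Import structures.
From mathcomp Require Import all_boot all_order all_algebra.
From mathcomp Require Import all_classical all_reals all_analysis.

Set Implicit Arguments.
Unset Strict Implicit.
Unset Printing Implicit Defensive.

Import Order.TTheory GRing.Theory Num.Theory.
Import numFieldNormedType.Exports.

Local Open Scope classical_set_scope.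
Local Open Scope ring_scope.

Section Euclidean.
Variable R : realType.
Local Notation vec := 'rV[R]_3.
Implicit Types (a b p u v d : vec) (A : set vec).

Definition dot u v : R := \sum_i u 0 i * v 0 i.

(* The library norm on 'rV[R]_3 is the sup norm, which induces the same
   topology. *)
Definition enorm u : R := Num.sqrt (dot u u).

(* Indices in 'I_3 are added modulo 3. *)
Definition cross u v : vec :=
  \row_i (u 0 (i + 1) * v 0 (i + 2) - u 0 (i + 2) * v 0 (i + 1)).

Definition grad (f : vec -> R^o) (x : vec) : vec :=
  \row_i 'D_(delta_mx 0 i : vec) f x.

Definition curl (f : vec -> vec) (x : vec) : vec :=
  \row_i ('D_(delta_mx 0 (i + 1) : vec) (fun y : vec => f y 0 (i + 2) : R^o) x
        - 'D_(delta_mx 0 (i + 2) : vec) (fun y : vec => f y 0 (i + 1) : R^o) x).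

Definition segment a b : set vec :=
  [set a + s *: (b - a) | s in [set` `[0 : R, 1]]].

Local Notation mu := (@lebesgue_measure R).

Definition volume A : R :=
  fine ((mu \x (mu \x mu))%E
    [set t | A (\row_(i < 3) [:: t.1; t.2.1; t.2.2]`_i)]).

(* Length of the part of the segment from a to b lying in A. *)
Definition length_in a b A : R :=
  enorm (b - a) * fine (mu [set s | 0 <= s <= 1 /\ A (a + s *: (b - a))]).

Definition line_int a b (g : vec -> R) : R :=
  enorm (b - a) * \int[mu]_(s in `[0, 1]) g (a + s *: (b - a)).

(* A chart (p, u, v) parametrizes the plane p + span(u, v) by
   (s, t) |-> p + s u + t v, whose surface element is |u x v| ds dt.  When u and
   v are linearly independent, [area] and [surf_int] restricted to subsets of
   that plane do not depend on the chart. *)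
Definition chart : Type := (vec * vec * vec)%type.

Definition chart_pt (c : chart) (t : R * R) : vec :=
  c.1.1 + t.1 *: c.1.2 + t.2 *: c.2.

Definition area (c : chart) A : R :=
  enorm (cross c.1.2 c.2) * fine ((mu \x mu)%E (chart_pt c @^-1` A)).

Definition surf_int (c : chart) A (g : vec -> R) : R :=
  enorm (cross c.1.2 c.2) *
  \int[(mu \x mu)%E]_(t in chart_pt c @^-1` A) g (chart_pt c t).

(* Some pair of independent vectors orthogonal to d (which exists if d != 0). *)
Definition normal_frame d : vec * vec :=
  get [set f : vec * vec |
    [/\ dot f.1 d = 0, dot f.2 d = 0 & cross f.1 f.2 != 0]].

End Euclidean.

(* Rectangular matrices indexed by finite types, through their enumerations. *)
Section FinMatrix.
Variable R : realType.

Definition fmx (S T : finType) (F : S -> T -> R) : 'M[R]_(#|S|, #|T|) :=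
  \matrix_(i, j) F (enum_val i) (enum_val j).

Definition fdiag (S : finType) (F : S -> R) : 'M[R]_(#|S|) :=
  diag_mx (\row_i F (enum_val i)).

Definition block3 (a b c : nat)
    (A11 : 'M[R]_a) (A12 : 'M[R]_(a, b)) (A13 : 'M[R]_(a, c))
    (A21 : 'M[R]_(b, a)) (A22 : 'M[R]_b) (A23 : 'M[R]_(b, c))
    (A31 : 'M[R]_(c, a)) (A32 : 'M[R]_(c, b)) (A33 : 'M[R]_c) :
  'M[R]_(a + b + c) :=
  block_mx (block_mx A11 A12 A21 A22) (col_mx A13 A23)
           (row_mx A31 A32) A33.

End FinMatrix.

(* [tet k] is the set of vertices of the tetrahedron D_k and [ccenter k] its
   circumcenter.  [fnormal s] is the unit normal chosen on the face with vertex
   set s; the choice of sign is arbitrary. *)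
Record mesh (R : realType) := Mesh {
  nD : nat;
  nV : nat;
  vtx : 'I_nD -> 'rV[R]_3;
  tet : 'I_nV -> {set 'I_nD};
  ccenter : 'I_nV -> 'rV[R]_3;
  fnormal : {set 'I_nD} -> 'rV[R]_3 }.

Section Mesh.
Variables (R : realType) (M : mesh R).
Local Notation vec := 'rV[R]_3.
Local Notation vid := 'I_(nD M).
Local Notation tid := 'I_(nV M).
Implicit Types (i j : vid) (k l m : tid) (s : {set vid}) (e : vid * vid).

Definition hull s : set vec :=
  [set p | exists w : vid -> R,
    [/\ forall i, 0 <= w i, forall i, i \notin s -> w i = 0,
        \sum_i w i = 1 & p = \sum_i w i *: vtx i]].

Definition D k : set vec := hull (tet k).

(* Open, bounded and polyhedral by construction. *)
Definition Omega : set vec := (\bigcup_(k in [set: tid]) D k)°.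

Definition bdry : set vec := closure Omega `\` Omega.

Definition face_of s k : bool := (#|s| == 3) && (s \subset tet k).

Definition common k m : {set vid} := tet k :&: tet m.

Definition adjacent k m : bool := #|common k m| == 3.

Definition normal_to s (n : vec) : Prop :=
  forall i j, i \in s -> j \in s -> dot n (vtx i - vtx j) = 0.

Record delaunay_voronoi_mesh : Prop := DelaunayVoronoiMesh {
  vtx_inj : injective (@vtx R M);
  vtx_used : forall i, exists k, i \in tet k;
  tet_inj : injective (@tet R M);
  tet_card : forall k, #|tet k| = 4;
  tet_affine_indep : forall k (w : vid -> R),
    (forall i, i \notin tet k -> w i = 0) -> \sum_i w i = 0 ->
    \sum_i w i *: vtx i = 0 -> forall i, w i = 0;
  tet_conforming : forall k m, D k `&` D m = hull (common k m);
  Omega_nonempty : Omega !=set0;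
  Omega_connected : connected Omega;
  ccenter_equidistant : forall k i j, i \in tet k -> j \in tet k ->
    enorm (ccenter k - vtx i) = enorm (ccenter k - vtx j);
  empty_circumball : forall k i j, i \in tet k ->
    enorm (ccenter k - vtx i) <= enorm (ccenter k - vtx j);
  ccenter_interior : forall k, (D k)° (ccenter k);
  (* A Voronoi edge is orthogonal to its Delaunay face as a segment to a
     triangle: it is perpendicular to the plane of the face and the two meet.
     That they meet does not follow from [ccenter_interior]: if the face has an
     obtuse angle, the segment joining the two circumcenters may pass through
     the plane outside of the face and run through a third tetrahedron. *)
  voronoi_edge_perp : forall k m, adjacent k m ->
    normal_to (common k m) (ccenter m - ccenter k);
  voronoi_edge_meets : forall k m, adjacent k m ->
    segment (ccenter k) (ccenter m) `&` hull (common k m) !=set0;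
  fnormal_unit : forall s k, face_of s k -> enorm (fnormal s) = 1;
  fnormal_normal : forall s k, face_of s k -> normal_to s (fnormal s) }.

(* Vertices, edges and faces carrying degrees of freedom.  Edges are ordered
   pairs with increasing indices; the face shared by D_k and D_m is the pair
   (k, m) with k < m. *)
Definition verts e : {set vid} := [set e.1; e.2].

Definition edge_of e l : bool := (e.1 < e.2)%N && (verts e \subset tet l).

Definition dof_vertex : finType :=
  {i : vid | `[< ~ bdry (vtx i) >]}.

Definition dof_edge : finType :=
  {e : vid * vid |
    [exists k, edge_of e k] && `[< ~ (hull (verts e) `<=` bdry) >]}.

Definition dof_face : finType :=
  {f : tid * tid | [&& (f.1 < f.2)%N, adjacent f.1 f.2 &
                      `[< ~ (hull (common f.1 f.2) `<=` bdry) >]]}.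

Definition fverts (f : dof_face) : {set vid} :=
  common (val f).1 (val f).2.

Definition edge_len e : R := enorm (vtx e.2 - vtx e.1).

Definition tangent e : vec := (edge_len e)^-1 *: (vtx e.2 - vtx e.1).

Definition face_chart s : chart R :=
  let v := [seq vtx i | i <- enum s] in (v`_0, v`_1 - v`_0, v`_2 - v`_0).

Definition face_area s : R := area (face_chart s) (hull s).

Definition cell i : set vec :=
  [set x | Omega x /\ forall j, j != i -> enorm (x - vtx i) <= enorm (x - vtx j)].

Definition voronoi_face e : set vec := cell e.1 `&` cell e.2.

(* The bisecting plane of the edge e, which contains [voronoi_face e]. *)
Definition voronoi_chart e : chart R :=
  let f := normal_frame (vtx e.2 - vtx e.1) in
  (2^-1 *: (vtx e.1 + vtx e.2), f.1, f.2).

Definition voronoi_face_area_in e (A : set vec) : R :=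
  area (voronoi_chart e) (voronoi_face e `&` A).

Definition voronoi_face_area e : R := area (voronoi_chart e) (voronoi_face e).

Definition voronoi_edge_len k m : R := enorm (ccenter m - ccenter k).

Definition Gmx : 'M[R]_(#|dof_edge|, #|dof_vertex|) :=
  fmx (fun (e : dof_edge) (v : dof_vertex) =>
    ((val e).2 == val v)%:R - ((val e).1 == val v)%:R).

(* The sign is + when the tangent of e runs counterclockwise around the normal
   of f (right-hand rule).  The sum has one term, for the vertex i of f opposite
   to e. *)
Definition incidence_sign (f : dof_face) e : R :=
  if verts e \subset fverts f then
    \sum_(i in fverts f :\: verts e)
      Num.sg (dot (fnormal (fverts f))
                  (cross (vtx e.2 - vtx e.1) (vtx i - vtx e.1)))
  else 0.

Definition Kmx : 'M[R]_(#|dof_face|, #|dof_edge|) :=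
  fmx (fun (f : dof_face) (e : dof_edge) => incidence_sign f (val e)).

Definition DeD : 'M[R]_(#|dof_edge|) := fdiag (fun e : dof_edge => edge_len (val e)).
Definition DpD : 'M[R]_(#|dof_face|) := fdiag (fun f => face_area (fverts f)).
Definition DeV : 'M[R]_(#|dof_face|) :=
  fdiag (fun f : dof_face => voronoi_edge_len (val f).1 (val f).2).
Definition DpV : 'M[R]_(#|dof_edge|) :=
  fdiag (fun e : dof_edge => voronoi_face_area (val e)).
Definition DV : 'M[R]_(#|dof_vertex|) :=
  fdiag (fun i : dof_vertex => volume (cell (val i))).

(* Piecewise polynomial functions: the piece of u on D_l is the polynomial u l,
   so that u l also gives the trace of u on the boundary of D_l, taken from
   inside D_l. *)
Definition sfield : Type := tid -> vec -> R.
Definition vfield : Type := tid -> vec -> vec.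

Definition broken_grad (u : sfield) : vfield := fun l => grad (u l).
Definition broken_curl (u : vfield) : vfield := fun l => curl (u l).

Definition H_grad (u : sfield) : Prop :=
  [/\ forall l, exists (a : R) (b : vec), forall x, u l x = a + dot b x,
      forall l m x, D l x -> D m x -> u l x = u m x &
      forall l x, D l x -> bdry x -> u l x = 0].

(* Tangential traces are single-valued on the common part of any two
   tetrahedra, and vanish on the faces and edges lying on the boundary.  On a
   face this says that u x n is continuous, resp. zero; the statements for edges
   are inherited from those for the faces around the edge. *)
Definition H_curl (u : vfield) : Prop :=
  [/\ forall l, exists a b : vec, forall x, u l x = a + cross b x,
      forall l m i j x, i \in common l m -> j \in common l m ->
        hull (common l m) x -> dot (u l x - u m x) (vtx i - vtx j) = 0 &
      forall l s i j x, s \subset tet l -> hull s `<=` bdry ->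
        i \in s -> j \in s -> hull s x -> dot (u l x) (vtx i - vtx j) = 0].

Definition H_div (u : vfield) : Prop :=
  [/\ forall l, exists (a : vec) (b : R), forall x, u l x = a + b *: x,
      forall l m n x, adjacent l m -> normal_to (common l m) n ->
        hull (common l m) x -> dot (u l x - u m x) n = 0 &
      forall l s n x, face_of s l -> hull s `<=` bdry -> normal_to s n ->
        hull s x -> dot (u l x) n = 0].

Definition edge_avg (g : vec -> vec) e : R :=
  (edge_len e)^-1 * line_int (vtx e.1) (vtx e.2) (fun x => dot (g x) (tangent e)).

Definition face_avg (g : vec -> vec) s : R :=
  (face_area s)^-1 *
  surf_int (face_chart s) (hull s) (fun x => dot (g x) (fnormal s)).

(* The degrees of freedom are evaluated from some tetrahedron containing the
   vertex, edge or face; on conforming functions the choice is immaterial. *)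
Definition eta_grad (i : dof_vertex) (u : sfield) : R :=
  if [pick l | val i \in tet l] is Some l then u l (vtx (val i)) else 0.

Definition eta_curl (e : dof_edge) (u : vfield) : R :=
  if [pick l | edge_of (val e) l] is Some l then edge_avg (u l) (val e) else 0.

Definition eta_div (f : dof_face) (u : vfield) : R :=
  face_avg (u (val f).1) (fverts f).

(* As the degrees of freedom are unisolvent, these determine the bases. *)
Definition grad_basis (phi : dof_vertex -> sfield) : Prop :=
  (forall b, H_grad (phi b)) /\ (forall a b, eta_grad a (phi b) = (a == b)%:R).

Definition curl_basis (phi : dof_edge -> vfield) : Prop :=
  (forall b, H_curl (phi b)) /\ (forall a b, eta_curl a (phi b) = (a == b)%:R).

Definition div_basis (phi : dof_face -> vfield) : Prop :=
  (forall b, H_div (phi b)) /\ (forall a b, eta_div a (phi b) = (a == b)%:R).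

Definition lump_p (u v : sfield) : R :=
  \sum_l \sum_(i in tet l)
    volume (D l `&` cell i) * u l (vtx i) * v l (vtx i).

Definition lump_E (u v : vfield) : R :=
  \sum_l \sum_(e : vid * vid | edge_of e l)
    voronoi_face_area_in e (D l) * edge_len e *
    edge_avg (u l) e * edge_avg (v l) e.

(* Boundary faces have no dual edge and do not contribute, as normal traces
   vanish there. *)
Definition lump_B (u v : vfield) : R :=
  \sum_l \sum_(m | adjacent l m)
    length_in (ccenter l) (ccenter m) (D l) * face_area (common l m) *
    face_avg (u l) (common l m) * face_avg (v l) (common l m).

Section Systems.
Variables (phig : dof_vertex -> sfield) (phic : dof_edge -> vfield)
  (phid : dof_face -> vfield) (tau : R).

Definition GFE : 'M[R]_(#|dof_edge|, #|dof_vertex|) :=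
  fmx (fun a b => eta_curl a (broken_grad (phig b))).
Definition KFE : 'M[R]_(#|dof_face|, #|dof_edge|) :=
  fmx (fun a b => eta_div a (broken_curl (phic b))).

Definition Mp : 'M[R]_(#|dof_vertex|) := fmx (fun a b => lump_p (phig a) (phig b)).
Definition ME : 'M[R]_(#|dof_edge|) := fmx (fun a b => lump_E (phic a) (phic b)).
Definition MB : 'M[R]_(#|dof_face|) := fmx (fun a b => lump_B (phid a) (phid b)).

Definition A_FE : 'M[R]_(#|dof_face| + #|dof_edge| + #|dof_vertex|) :=
  block3
    ((2 / tau) *: MB)      (MB *m KFE)            0
    (- (KFE^T *m MB))      ((2 / tau) *: ME)      (ME *m GFE)
    0                      (- (GFE^T *m ME))      ((2 / tau) *: Mp).

Definition A_SFE : 'M[R]_(#|dof_face| + #|dof_edge| + #|dof_vertex|) :=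
  block3
    (invmx DpD *m invmx DeV)  0                        0
    0                         (invmx DpV *m invmx DeD) 0
    0                         0                        (invmx DV)
  *m A_FE.

Definition A_MFD : 'M[R]_(#|dof_face| + #|dof_edge| + #|dof_vertex|) :=
  block3
    ((2 / tau) *: 1%:M)            (invmx DpD *m Kmx *m DeD)     0
    (- (invmx DpV *m Kmx^T *m DeV)) ((2 / tau) *: 1%:M)          (invmx DeD *m Gmx)
    0                              (- (invmx DV *m Gmx^T *m DpV)) ((2 / tau) *: 1%:M).

End Systems.
End Mesh.

(* Main.v *)
From HB Require Import structures.
Require Import Defs.
From mathcomp Require Import all_boot all_order all_algebra.
From mathcomp Require Import all_classical all_reals all_analysis.
From mathcomp Require Import ring lra.

Set Implicit Arguments.
Unset Strict Implicit.
Unset Printing Implicit Defensive.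

Import Order.TTheory GRing.Theory Num.Theory.
Import numFieldNormedType.Exports.

Local Open Scope classical_set_scope.
Local Open Scope ring_scope.

(** The theorem is block algebra once five matrices are computed: the lumped mass
    matrices are the diagonal matrices |f| |e^V|, |V_ij| |e_ij| and |V_i|
    ([MB_E], [ME_E], [Mp_E]), with nonzero entries, and
    G^FE = D_e^-1 G, K^FE = D_f^-1 K D_e ([GFE_E], [KFE_E]).  The left scaling
    then turns each lumped mass matrix into an identity matrix, and the products
    of the others telescope.

    The two identities for the derivatives hold because all fields are affine:
    the tangential component of a gradient along an edge is a difference quotient,
    and Stokes' theorem on a triangle writes the flux of a curl as a signed sum of
    edge integrals.  The degrees of freedom have the same value from all
    tetrahedra and vanish on the boundary, so that basis functions satisfy
    delta relations in each tetrahedron ([grad_basis_vtx], [curl_basis_edge],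
    [div_basis_face]).  This makes the lumped mass matrices diagonal; their
    entries are sums of the pieces |D_l /\ V_i|, etc., over the tetrahedra D_l
    around a vertex, an edge or a face.

    That the pieces add up to the whole dual cell, face or edge is the geometric
    core.  The dual objects must not leave the star of the vertex or edge A to
    which they belong ([voronoi_in_star]).  As A meets Omega, the tetrahedra around A
    fill a neighbourhood ([fan]) and all faces that contain A are shared
    ([face_shared]); a shared face contains its circumcenter, because its Voronoi
    edge meets it orthogonally ([face_circumcenter]).  So every simplex between A
    and a tetrahedron around A contains its circumcenter, and an induction on
    these simplices shows that a point of the cone of D_k at A that is at least
    as close to A as to the other vertices of D_k lies in D_k
    ([voronoi_in_hull]).  The pieces overlap in null sets since the mesh is
    conforming.

    Of the diagonal entries only the areas of Voronoi faces are not obviously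
    positive.  They are, since the circumcenters of three tetrahedra around an
    interior edge are not collinear ([voronoi_face_triangle]). *)

(** * Vectors of three-space *)

Section VectorAlgebra.
Variable R : realType.
Implicit Types (u v w z p q x b : 'rV[R]_3) (s t : R).

Lemma dotE u v :
  dot u v = u 0 0 * v 0 0 + u 0 1 * v 0 1 + u 0 2%:R * v 0 2%:R.
Proof.
rewrite /dot !big_ord_recl big_ord0 addr0 addrA.
have -> : lift ord0 ord0 = 1 :> 'I_3 by apply/val_inj.
by have -> : lift ord0 (lift ord0 ord0) = 2%:R :> 'I_3 by apply/val_inj.
Qed.

Lemma crossE0 u v : cross u v 0 0 = u 0 1 * v 0 2%:R - u 0 2%:R * v 0 1.
Proof. by rewrite mxE !add0r. Qed.

Lemma crossE1 u v : cross u v 0 1 = u 0 2%:R * v 0 0 - u 0 0 * v 0 2%:R.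
Proof. by rewrite mxE; congr (u _ _ * v _ _ - u _ _ * v _ _); apply/val_inj. Qed.

Lemma crossE2 u v : cross u v 0 2%:R = u 0 0 * v 0 1 - u 0 1 * v 0 0.
Proof. by rewrite mxE; congr (u _ _ * v _ _ - u _ _ * v _ _); apply/val_inj. Qed.

Lemma ord3P (P : 'I_3 -> Prop) : P 0 -> P 1 -> P 2%:R -> forall i, P i.
Proof.
move=> P0 P1 P2 [[|[|[|//]]] i3].
- by rewrite (_ : Ordinal i3 = 0) //; apply/val_inj.
- by rewrite (_ : Ordinal i3 = 1) //; apply/val_inj.
- by rewrite (_ : Ordinal i3 = 2%:R) //; apply/val_inj.
Qed.

Lemma vec3P u v :
  u 0 0 = v 0 0 -> u 0 1 = v 0 1 -> u 0 2%:R = v 0 2%:R -> u = v.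
Proof. by move=> e0 e1 e2; apply/rowP; apply: ord3P. Qed.

Lemma vecDE u v i : (u + v) 0 i = u 0 i + v 0 i. Proof. exact: mxE. Qed.

Lemma vecNE u i : (- u) 0 i = - u 0 i. Proof. exact: mxE. Qed.

Lemma vecZE s u i : (s *: u) 0 i = s * u 0 i. Proof. exact: mxE. Qed.

Lemma vec0E i : (0 : 'rV[R]_3) 0 i = 0. Proof. exact: mxE. Qed.

Definition vecE :=
  (dotE, crossE0, crossE1, crossE2, vecDE, vecNE, vecZE, vec0E).

Ltac vec_ring := by rewrite !vecE; ring.

Lemma dotC u v : dot u v = dot v u.
Proof. by rewrite /dot; apply: eq_bigr => i _; rewrite mulrC. Qed.

Lemma dotDr u v w : dot u (v + w) = dot u v + dot u w.
Proof. by rewrite /dot -big_split; apply: eq_bigr => i _; rewrite mxE mulrDr. Qed.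

Lemma dotZr s u v : dot u (s *: v) = s * dot u v.
Proof. by rewrite /dot mulr_sumr; apply: eq_bigr => i _; rewrite mxE mulrCA. Qed.

Lemma dotNr u v : dot u (- v) = - dot u v.
Proof. by rewrite -scaleN1r dotZr mulN1r. Qed.

Lemma dotBr u v w : dot u (v - w) = dot u v - dot u w.
Proof. by rewrite dotDr dotNr. Qed.

Lemma dot0r u : dot u 0 = 0.
Proof. by rewrite -(scale0r u) dotZr mul0r. Qed.

Lemma dotDl u v w : dot (v + w) u = dot v u + dot w u.
Proof. by rewrite !(dotC _ u) dotDr. Qed.

Lemma dotZl s u v : dot (s *: u) v = s * dot u v.
Proof. by rewrite !(dotC _ v) dotZr. Qed.

Lemma dotNl u v : dot (- v) u = - dot v u.
Proof. by rewrite !(dotC _ u) dotNr. Qed.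

Lemma dotBl u v w : dot (v - w) u = dot v u - dot w u.
Proof. by rewrite !(dotC _ u) dotBr. Qed.

Lemma dot0l u : dot 0 u = 0.
Proof. by rewrite dotC dot0r. Qed.

Lemma dot_sumr (I : finType) (P : pred I) u (F : I -> 'rV[R]_3) :
  dot u (\sum_(i | P i) F i) = \sum_(i | P i) dot u (F i).
Proof.
by apply: (big_morph (dot u)) => [v w|]; rewrite ?dotDr ?dot0r.
Qed.

Definition dotDE := (dotDl, dotDr, dotZl, dotZr, dotNl, dotNr).

Lemma dot_ge0 u : 0 <= dot u u.
Proof. by apply: sumr_ge0 => i _; rewrite -expr2 sqr_ge0. Qed.

Lemma dot_eq0 u : (dot u u == 0) = (u == 0).
Proof.
apply/idP/eqP => [|->]; last by rewrite dot0r.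
rewrite psumr_eq0 => [/allP u0|i _]; last by rewrite -expr2 sqr_ge0.
apply/rowP => i; rewrite mxE; apply/eqP.
by have := u0 i (mem_index_enum i); rewrite mulf_eq0 orbb.
Qed.

Lemma dot_gt0 u : u != 0 -> 0 < dot u u.
Proof. by move=> u0; rewrite lt_neqAle eq_sym dot_eq0 u0 dot_ge0. Qed.

Lemma enorm_ge0 u : 0 <= enorm u.
Proof. exact: sqrtr_ge0. Qed.

Lemma enorm_sqr u : enorm u ^+ 2 = dot u u.
Proof. by rewrite sqr_sqrtr // dot_ge0. Qed.

Lemma enorm_eq0 u : (enorm u == 0) = (u == 0).
Proof. by rewrite -(sqrf_eq0 (enorm u)) enorm_sqr dot_eq0. Qed.

Lemma enorm_gt0 u : u != 0 -> 0 < enorm u.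
Proof. by move=> u0; rewrite lt_neqAle eq_sym enorm_eq0 u0 enorm_ge0. Qed.

Lemma enormZ s u : enorm (s *: u) = `|s| * enorm u.
Proof.
by rewrite /enorm dotZl dotZr mulrA -expr2 sqrtrM ?sqr_ge0 // sqrtr_sqr.
Qed.

Lemma enormBC u v : enorm (u - v) = enorm (v - u).
Proof. by rewrite -opprB -scaleN1r enormZ normrN1 mul1r. Qed.

(** This is |x - p|^2 - |x - q|^2, written as the affine function of x that it is. *)
Definition bisect p q x : R :=
  dot p p - dot q q + dot (2 *: (q - p)) x.

Lemma bisectE p q x : bisect p q x = dot (x - p) (x - p) - dot (x - q) (x - q).
Proof. by rewrite /bisect !vecE; ring. Qed.

Lemma enorm_le_bisect p q x : (enorm (x - p) <= enorm (x - q)) = (bisect p q x <= 0).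
Proof.
by rewrite bisectE subr_le0 -!enorm_sqr ler_sqr ?nnegrE ?enorm_ge0.
Qed.

Lemma enorm_eq_bisect p q x : enorm (x - p) = enorm (x - q) -> bisect p q x = 0.
Proof. by move=> e; rewrite bisectE -!enorm_sqr e subrr. Qed.

Lemma cross_cross u v w : cross u (cross v w) = dot u w *: v - dot u v *: w.
Proof. by apply: vec3P; vec_ring. Qed.

Lemma dot_crossl u v : dot (cross u v) u = 0.
Proof. vec_ring. Qed.

Lemma crossC u v : cross u v = - cross v u.
Proof. by apply: vec3P; vec_ring. Qed.

Lemma crossDr u v w : cross w (u + v) = cross w u + cross w v.
Proof. by apply: vec3P; vec_ring. Qed.

Lemma crossZr s u w : cross w (s *: u) = s *: cross w u.
Proof. by apply: vec3P; vec_ring. Qed.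

Lemma orth2_colinear u v w : cross u v != 0 -> dot w u = 0 -> dot w v = 0 ->
  w = (dot w (cross u v) / dot (cross u v) (cross u v)) *: cross u v.
Proof.
set n := cross u v => n0 wu wv.
have nn : dot n n != 0 by rewrite dot_eq0.
have h : cross n (cross w n) = dot n n *: w - dot n w *: n by rewrite cross_cross.
have cwn : cross w n = 0 by rewrite /n cross_cross wu wv !scale0r subrr.
rewrite cwn in h.
have : dot n n *: w = dot n w *: n.
  apply/eqP; rewrite -subr_eq0 -h; apply/eqP; apply: vec3P; vec_ring.
move=> e; apply: (scalerI nn); rewrite e scalerA.
by rewrite mulrCA divff // mulr1 dotC.
Qed.

(** Both d and w are multiples of the normal of the plane of u and v, and they are
    orthogonal. *)
Lemma orth3_eq0 u v d w : cross u v != 0 -> d != 0 ->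
  dot d u = 0 -> dot d v = 0 -> dot w u = 0 -> dot w v = 0 -> dot w d = 0 ->
  w = 0.
Proof.
move=> n0 d0 du dv wu wv wd.
have [c1 dn] : exists c, d = c *: cross u v.
  by eexists; exact: orth2_colinear n0 du dv.
have [c2 wn] : exists c, w = c *: cross u v.
  by eexists; exact: orth2_colinear n0 wu wv.
move: d0 wd; rewrite dn wn dotZl dotZr scaler_eq0 (negbTE n0) orbF => c10.
move/eqP; rewrite !mulf_eq0 dot_eq0 (negbTE n0) (negbTE c10) !orbF => /eqP ->.
by rewrite scale0r.
Qed.

(** Cramer's rule in the plane orthogonal to d: the coefficients are quotients of
    signed areas. *)
Lemma span2 u v w d : cross u v != 0 -> d != 0 ->
  dot d u = 0 -> dot d v = 0 -> dot d w = 0 ->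
  exists s t, w = s *: u + t *: v.
Proof.
move=> n0 d0 du dv dw.
have nn : dot (cross u v) (cross u v) != 0 by rewrite dot_eq0.
set n := cross u v in n0 nn *.
pose s := dot (cross w v) n / dot n n; pose t := dot (cross u w) n / dot n n.
exists s, t; apply/eqP; rewrite -subr_eq0; apply/eqP.
have E : dot n n *: (w - (s *: u + t *: v)) = dot n w *: n.
  have -> : dot n n *: (w - (s *: u + t *: v)) =
     dot n n *: w - (dot (cross w v) n *: u + dot (cross u w) n *: v).
    rewrite scalerBr scalerDr !scalerA /s /t.
    by congr (_ - (_ *: _ + _ *: _)); rewrite mulrC divfK.
  by rewrite /n; apply: vec3P; vec_ring.
have nw : dot n w = 0.
  have := orth2_colinear n0 du dv; rewrite -/n => dn.
  have : dot d w = 0 by [].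
  rewrite dn dotZl => /eqP; rewrite mulf_eq0 => /orP[/eqP c0|/eqP //].
  by move: d0; rewrite dn c0 scale0r eqxx.
move: E; rewrite nw scale0r => /eqP; rewrite scaler_eq0 (negbTE nn) /=.
by move=> /eqP.
Qed.

(** The points f - s d form a line, and those with s = 0 and s = 1 are the two where
    it meets the sphere of radius |f| around the origin. *)
Lemma line_sphere (f d : 'rV[R]_3) s : d != 0 ->
  dot f f - dot (f - s *: d) (f - s *: d) = 0 ->
  dot f f - dot (f - d) (f - d) = 0 -> s = 0 \/ s = 1.
Proof.
move=> d0; rewrite !dotDE [dot d f]dotC => E1 E2.
have : (s * (1 - s)) * dot d d = 0.
  have fd : dot f d = dot d d / 2 by lra.
  by rewrite -[RHS]E1 fd; field.
move=> /eqP; rewrite !mulf_eq0 dot_eq0 (negbTE d0) orbF subr_eq0.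
by case/orP => /eqP; [left|right].
Qed.

Lemma normal_frameP (d : 'rV[R]_3) : d != 0 ->
  [/\ dot (normal_frame d).1 d = 0, dot (normal_frame d).2 d = 0 &
      cross (normal_frame d).1 (normal_frame d).2 != 0].
Proof.
move=> d0; rewrite /normal_frame.
suff /getPex : exists f : 'rV[R]_3 * 'rV[R]_3,
    [set f | [/\ dot f.1 d = 0, dot f.2 d = 0 & cross f.1 f.2 != 0]] f by [].
have key f : dot f d = 0 -> f != 0 ->
    exists f2, [/\ dot f d = 0, dot f2 d = 0 & cross f f2 != 0].
  move=> fd f0; exists (cross d f); rewrite dot_crossl; split=> //.
  rewrite cross_cross fd scale0r subr0 scaler_eq0 negb_or d0 andbT.
  by rewrite dot_eq0.
have [f [fd f0]] : exists f, dot f d = 0 /\ f != 0.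
  have [d00|d00] := eqVneq (d 0 0) 0.
    exists (delta_mx 0 0); rewrite dotE !mxE /= d00; split; first by ring.
    by apply/eqP => /rowP /(_ 0) /eqP; rewrite !mxE /= oner_eq0.
  exists (cross d (delta_mx 0 1)); rewrite dot_crossl; split => //.
  apply: contraNneq d00 => /rowP /(_ 2%:R).
  by rewrite crossE2 !mxE /= mulr1 mulr0 subr0 => ->.
have [f2 f2P] := key f fd f0.
by exists (f, f2).
Qed.

Lemma cvg_dot b x : dot b y @[y --> x] --> dot b x.
Proof.
have cc (i : 'I_3) : b 0 i * y 0 i @[y --> x] --> b 0 i * x 0 i.
  by apply: cvgM; [exact: cvg_cst|exact: coord_continuous].
have -> : (fun y => dot b y : R) =
    fun y => b 0 0 * y 0 0 + b 0 1 * y 0 1 + b 0 2%:R * y 0 2%:R.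
  by apply/funext => y; rewrite dotE.
rewrite dotE; exact: (cvgD (cvgD (cc 0) (cc 1)) (cc 2%:R)).
Qed.

Lemma continuous_affine (a : R) b : continuous (fun x => a + dot b x : R).
Proof.
have h (x : 'rV[R]_3) : a + dot b y @[y --> x] --> a + dot b x.
  apply: (@cvgD R R^o 'rV[R]_3 (nbhs x) _ (fun=> a) (dot b) a (dot b x)).
    exact: cvg_cst.
  exact: cvg_dot.
by move=> x; exact: h.
Qed.

End VectorAlgebra.
Ltac vec_ring := by rewrite !vecE; ring.

(** * Lebesgue measure of the plane and of space *)

Section CountableBase.

(** Asking the members of the base to be in m makes the notion pass to products,
    whose sigma-algebra is generated by rectangles. *)
Definition countable_base (T : topologicalType) (m : set (set T)) : Prop :=
  exists B : nat -> set T, (forall n, m (B n)) /\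
    forall (U : set T) x, nbhs x U -> exists n, B n x /\ B n `<=` U.

Lemma countable_base_prod (T1 T2 : topologicalType) (m1 : set (set T1))
    (m2 : set (set T2)) (m : set (set (T1 * T2))) :
  (forall A B, m1 A -> m2 B -> m (A `*` B)) ->
  countable_base m1 -> countable_base m2 -> countable_base m.
Proof.
move=> mX [B1 [mB1 b1]] [B2 [mB2 b2]].
pose B n := if unpickle n is Some p then B1 p.1 `*` B2 p.2 else B1 0 `*` B2 0.
exists B; split=> [n|U [x y] [[P Q] /= [Px Qy] PQU]].
  by rewrite /B; case: unpickle => [p|]; apply: mX.
have [i [Bx BP]] := b1 _ _ Px; have [j [By BQ]] := b2 _ _ Qy.
exists (pickle (i, j)); rewrite /B pickleK /=; split => //.
by move=> [x' y'] [/= /BP Px' /BQ Qy']; apply: PQU.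
Qed.

Lemma open_measurable_base (T : topologicalType)
    (m : set (set T)) :
  (forall F : nat -> set T, (forall n, m (F n)) -> m (\bigcup_n F n)) ->
  m set0 ->
  countable_base m -> forall U, open U -> m U.
Proof.
move=> mU m0 [B [mB bB]] U oU.
rewrite (_ : U = \bigcup_n (if `[< B n `<=` U >] then B n else set0)).
  by apply: mU => n; case: asboolP.
apply/seteqP; split=> [x Ux|x [n _]]; last by case: asboolP => // BU /BU.
have [|n [Bx BU]] := bB U x; first exact: open_nbhs_nbhs.
by exists n => //; case: asboolP.
Qed.

Variable R : realType.
Local Notation mR := (measurableTypeR R).

Lemma countable_base_R : countable_base (T := R) (@measurable _ mR).
Proof.
pose B n : set R :=
  if unpickle n is Some p then ball (ratr p.1 : R) (ratr p.2 : R) else set0.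
exists B; split=> [n|U x nU].
  rewrite /B; case: unpickle => [p|//].
  by apply: measurable_realfun.open_measurable; exact: ball_open.
have [|c [r /= []]] := @open_subball_rat R U° x (@open_interior _ _).
  by rewrite inE; exact: nU.
rewrite inE => xB BU; exists (pickle (c, r)); rewrite /B pickleK /=; split=> //.
by apply: subset_trans BU _; exact: interior_subset.
Qed.

Lemma open_measurable2 (U : set (R * R)) : open U -> measurable (U : set (mR * mR)).
Proof.
apply: open_measurable_base => //; first exact: bigcupT_measurable.
apply: (countable_base_prod _ countable_base_R countable_base_R) => A B mA mB.
exact: measurableX.
Qed.

Lemma open_measurable3 (U : set (R * (R * R))) : open U ->
  measurable (U : set (mR * (mR * mR))).
Proof.
apply: open_measurable_base => //; first exact: bigcupT_measurable.
apply: (countable_base_prod (m1 := @measurable _ mR)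
  (m2 := @measurable _ (mR * mR)%type)).
- by move=> A B mA mB; exact: measurableX.
- exact: countable_base_R.
apply: (countable_base_prod _ countable_base_R countable_base_R) => A B mA mB.
exact: measurableX.
Qed.

Lemma closed_measurable2 (U : set (R * R)) :
  closed U -> measurable (U : set (mR * mR)).
Proof.
move=> cU; rewrite -(setCK U); apply: measurableC.
by apply: open_measurable2; exact: closed_openC.
Qed.

Lemma closed_measurable3 (U : set (R * (R * R))) :
  closed U -> measurable (U : set (mR * (mR * mR))).
Proof.
move=> cU; rewrite -(setCK U); apply: measurableC.
by apply: open_measurable3; exact: closed_openC.
Qed.

End CountableBase.

Section PlaneAndSpaceMeasure.
Variable R : realType.
Local Notation mR := (measurableTypeR R).
Local Notation mu := (@lebesgue_measure R).

(** The sigma-finite structure of the product, which the product with a third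
    factor needs, is not found by inference. *)
Definition lebesgue2 : {sigma_finite_measure set (mR * mR)%type -> \bar R} :=
  HB.pack (mu \x mu)%E
    (@lebesgue_integral_fubini.measure_function_Measure_isSigmaFinite__to__measure_function_isSigmaFinite
      _ _ mR mR R mu mu)
    (@lebesgue_integral_fubini.measure_function_Measure_isSigmaFinite__to__measure_function_isSFinite
      _ _ mR mR R mu mu).

Definition lebesgue3 : {measure set (mR * (mR * mR))%type -> \bar R} :=
  (mu \x lebesgue2)%E.

Lemma lebesgue2E (A B : set mR) : measurable A -> measurable B ->
  lebesgue2 (A `*` B) = (mu A * mu B)%E.
Proof. exact: (@product_measure1E _ _ mR mR R mu mu). Qed.

Lemma lebesgue3E (A B C : set mR) :
  measurable A -> measurable B -> measurable C ->
  lebesgue3 (A `*` (B `*` C)) = (mu A * (mu B * mu C))%E.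
Proof.
move=> mA mB mC; rewrite -lebesgue2E //.
by apply: (@product_measure1E _ _ mR (mR * mR)%type R mu lebesgue2) => //;
  exact: measurableX.
Qed.

Lemma le_lebesgue2 (A B : set (mR * mR)) : measurable A -> measurable B ->
  A `<=` B -> (lebesgue2 A <= lebesgue2 B)%E.
Proof. by move=> mA mB AB; apply: (@le_measure _ _ _ lebesgue2); rewrite ?inE. Qed.

Lemma le_lebesgue3 (A B : set (mR * (mR * mR))) : measurable A -> measurable B ->
  A `<=` B -> (lebesgue3 A <= lebesgue3 B)%E.
Proof. by move=> mA mB AB; apply: (@le_measure _ _ _ lebesgue3); rewrite ?inE. Qed.

Lemma measure2_open_gt0 (U : set (mR * mR)) (x : R * R) :
  nbhs x (U : set (R * R)) -> measurable U -> (0 < lebesgue2 U)%E.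
Proof.
move=> /nbhs_ballP[r /= r0 rU] mU.
pose I c : set mR := `]c - r, c + r[%classic.
have mI c : measurable (I c) by exact: measurable_itv.
have lI c : mu (I c) = (r *+ 2)%:E.
  by rewrite /I -ball_itv lebesgue_measure_ball // ltW.
apply: (@lt_le_trans _ _ (lebesgue2 (I x.1 `*` I x.2))); last first.
  apply: le_lebesgue2 => //; first exact: measurableX.
  by move=> [y1 y2] [/= h1 h2]; apply: rU; split; rewrite ball_itv.
by rewrite lebesgue2E // !lI -EFinM lte_fin mulr_gt0 // pmulrn_lgt0.
Qed.

Lemma measure3_open_gt0 (U : set (mR * (mR * mR))) (x : R * (R * R)) :
  nbhs x (U : set (R * (R * R))) -> measurable U -> (0 < lebesgue3 U)%E.
Proof.
move=> /nbhs_ballP[r /= r0 rU] mU.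
pose I c : set mR := `]c - r, c + r[%classic.
have mI c : measurable (I c) by exact: measurable_itv.
have lI c : mu (I c) = (r *+ 2)%:E.
  by rewrite /I -ball_itv lebesgue_measure_ball // ltW.
have mII : measurable (I x.2.1 `*` I x.2.2) by exact: measurableX.
apply: (@lt_le_trans _ _ (lebesgue3 (I x.1 `*` (I x.2.1 `*` I x.2.2)))); last first.
  apply: le_lebesgue3 => //; first exact: measurableX.
  move=> [y1 [y2 y3]] [/= h1 [/= h2 h3]]; apply: rU.
  by split; [|split]; rewrite /= ball_itv.
rewrite lebesgue3E // !lI.
by rewrite -!EFinM lte_fin !mulr_gt0 // pmulrn_lgt0.
Qed.

Lemma measure2_bounded (A : set (mR * mR)) (r : R) : measurable A ->
  (forall t, A t -> `|t.1| <= r /\ `|t.2| <= r) -> (lebesgue2 A < +oo)%E.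
Proof.
move=> mA Ar; apply: (@le_lt_trans _ _ (lebesgue2 (`[- r, r] `*` `[- r, r]))).
  apply: le_lebesgue2 => //; first exact: measurableX.
  move=> t /Ar [h1 h2]; split; rewrite /= in_itv /= -ler_norml //.
rewrite lebesgue2E // lebesgue_measure_itv.
by case: ifP => _; rewrite ?mule0 // -EFinD -EFinM ltry.
Qed.

Lemma measure3_bounded (A : set (mR * (mR * mR))) (r : R) : measurable A ->
  (forall t, A t -> [/\ `|t.1| <= r, `|t.2.1| <= r & `|t.2.2| <= r]) ->
  (lebesgue3 A < +oo)%E.
Proof.
move=> mA Ar.
apply: (@le_lt_trans _ _ (lebesgue3 (`[- r, r] `*` (`[- r, r] `*` `[- r, r])))).
  apply: le_lebesgue3 => //; first by do !apply: measurableX.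
  by move=> t /Ar [h1 h2 h3]; split; [|split]; rewrite /= in_itv /= -ler_norml.
rewrite lebesgue3E // lebesgue_measure_itv.
by case: ifP => _; rewrite ?mule0 // -EFinD -!EFinM ltry.
Qed.

(** One exceptional section is enough for affine equations: if such an equation
    does not involve the second component, it fixes the first one. *)
Lemma product_null d (T : measurableType d)
    (m : {sigma_finite_measure set T -> \bar R}) (A : set (mR * T)) (c : R) :
  measurable A -> (forall x, x != c -> m (xsection A x) = 0%E) ->
  (mu \x m)%E A = 0%E.
Proof.
move=> mA A0; rewrite /product_measure1.
rewrite (ae_eq_integral (cst 0%E)) //; first by rewrite integral0.
  exact: measurable_fun_xsection.
exists [set c]; split => //; first exact: lebesgue_measure_set1.
move=> x /=; apply: contra_notP => /eqP xc _; exact: A0.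
Qed.

Lemma affine2_measurable (a b1 b2 : R) :
  measurable [set t : mR * mR | a + b1 * t.1 + b2 * t.2 = 0].
Proof.
apply: closed_measurable2.
rewrite (_ : [set t | _] = (fun t : R * R => a + b1 * t.1 + b2 * t.2) @^-1` [set 0]) //.
apply: closed_comp => [t _|]; last exact: closed_eq.
apply: cvgD; [apply: cvgD; first exact: cvg_cst|]; apply: cvgM;
  by [exact: cvg_cst|exact: cvg_fst|exact: cvg_snd].
Qed.

Lemma affine3_measurable (a b1 b2 b3 : R) :
  measurable [set t : mR * (mR * mR) | a + b1 * t.1 + b2 * t.2.1 + b3 * t.2.2 = 0].
Proof.
apply: closed_measurable3.
rewrite (_ : [set t | _] = (fun t : R * (R * R) =>
  a + b1 * t.1 + b2 * t.2.1 + b3 * t.2.2) @^-1` [set 0]) //.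
apply: closed_comp => [t _|]; last exact: closed_eq.
have c2 : (fun t : R * (R * R) => t.2) @ t --> t.2 by exact: cvg_snd.
apply: cvgD; [apply: cvgD; [apply: cvgD; first exact: cvg_cst|]|]; apply: cvgM;
  try exact: cvg_cst.
- exact: cvg_fst.
- by apply: (cvg_comp _ _ c2); exact: cvg_fst.
- by apply: (cvg_comp _ _ c2); exact: cvg_snd.
Qed.

Lemma line_null (a b1 b2 : R) : (b1 != 0) || (b2 != 0) ->
  lebesgue2 [set t : mR * mR | a + b1 * t.1 + b2 * t.2 = 0] = 0%E.
Proof.
move=> b0; apply: (@product_null _ _ mu _ (- a / b1)).
  exact: affine2_measurable.
move=> x xc; have [b20|b20] := eqVneq b2 0.
  rewrite b20 eqxx orbF in b0.
  rewrite (_ : xsection _ _ = set0) ?measure0 //.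
  apply/seteqP; split=> y //; rewrite xsectionE /= => e.
  move/eqP: xc; apply; apply: (mulIf b0); rewrite divfK //.
  move: e; rewrite b20 mul0r addr0 => /eqP; rewrite addr_eq0 mulrC => /eqP ->.
  by rewrite opprK.
apply/eqP; rewrite eq_le measure_ge0 andbT.
rewrite -(lebesgue_measure_set1 (- (a + b1 * x) / b2)).
apply: le_measure; rewrite ?inE.
- by apply: measurable_xsection; exact: affine2_measurable.
- exact: measurable_set1.
move=> y; rewrite xsectionE /= => /eqP; rewrite addr_eq0 => /eqP ->.
by rewrite opprK mulrC mulKf.
Qed.

Lemma plane_null (a b1 b2 b3 : R) : [|| b1 != 0, b2 != 0 | b3 != 0] ->
  lebesgue3 [set t : mR * (mR * mR) | a + b1 * t.1 + b2 * t.2.1 + b3 * t.2.2 = 0] = 0%E.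
Proof.
move=> b0; apply: (@product_null _ _ lebesgue2 _ (- a / b1)).
  exact: affine3_measurable.
move=> x xc.
have -> : xsection
      [set t : mR * (mR * mR) | a + b1 * t.1 + b2 * t.2.1 + b3 * t.2.2 = 0] x =
    [set t : mR * mR | (a + b1 * x) + b2 * t.1 + b3 * t.2 = 0].
  by apply/seteqP; split=> y; rewrite xsectionE.
have [b230|] := boolP ((b2 != 0) || (b3 != 0)); first exact: line_null.
rewrite negb_or !negbK => /andP[/eqP b20 /eqP b30].
rewrite b20 b30 !eqxx /= orbF in b0 *.
rewrite (_ : [set t | _] = set0) ?measure0 //.
apply/seteqP; split=> y //=; rewrite !mul0r !addr0 => /eqP.
rewrite addr_eq0 => /eqP e; move/eqP: xc; apply; apply: (mulIf b0).
by rewrite divfK // e opprK mulrC.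
Qed.

Lemma triangle_measurable :
  measurable [set t : mR * mR | [/\ 0 <= t.1, 0 <= t.2 & t.1 + t.2 <= 1]].
Proof.
apply: closed_measurable2.
have cf (f : R * R -> R) (r : R) : continuous f -> closed [set t | r <= f t].
  move=> cf; apply: (@closed_comp _ _ f [set t | r <= t]); last exact: closed_ge.
  by move=> t _; exact: cf.
have c1 : continuous (fun t : R * R => t.1) by move=> t; exact: cvg_fst.
have c2 : continuous (fun t : R * R => t.2) by move=> t; exact: cvg_snd.
have c3 : continuous (fun t : R * R => 1 - (t.1 + t.2)).
  by move=> t; apply: cvgB; [exact: cvg_cst|apply: cvgD; [exact: c1|exact: c2]].
rewrite (_ : [set t | _] = [set t | 0 <= t.1] `&` [set t | 0 <= t.2] `&`
    [set t | 0 <= 1 - (t.1 + t.2)]).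
  by do !apply: closedI; exact: cf.
apply/seteqP; split=> t /=; first by case=> h1 h2; rewrite -subr_ge0.
by case=> -[h1 h2]; rewrite subr_ge0.
Qed.

(** The section over x has length 1 - x. *)
Lemma triangle_area :
  lebesgue2 [set t : mR * mR | [/\ 0 <= t.1, 0 <= t.2 & t.1 + t.2 <= 1]] = (2^-1)%:E.
Proof.
rewrite /product_measure1.
have xs (x : R) :
    xsection [set t : mR * mR | [/\ 0 <= t.1, 0 <= t.2 & t.1 + t.2 <= 1]] x =
    if 0 <= x then `[0, 1 - x]%classic else set0.
  apply/seteqP; split=> y; rewrite xsectionE /=.
    by case=> -> h1 h2; rewrite /= in_itv /= h1 lerBrDl.
  by case: ifP => //= x0; rewrite in_itv /= lerBrDl => /andP[].
transitivity (\int[mu]_(x in `[0%R, 1%R]) (1 - x)%:E)%E.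
  rewrite [RHS]integral_mkcond; apply: eq_integral => x _ /=.
  rewrite xs patchE /=; case: ifPn => x0; last first.
    rewrite measure0 memNset //= in_itv /= => /andP[x0' _].
    by rewrite x0' in x0.
  rewrite lebesgue_measure_itv /= lte_fin subr_gt0.
  case: ifPn => [x1|]; first by rewrite mem_set /= ?in_itv /= ?x0 ?ltW // oppr0 adde0.
  rewrite -leNgt => x1; case: ifPn => //; rewrite inE /= in_itv /= => /andP[_ x1'].
  by rewrite (_ : x = 1) ?subrr //; apply/eqP; rewrite eq_le x1' x1.
pose F (x : R) : R := x - 2^-1 * x ^+ 2.
have dF (x : R) : is_derive x 1 F (1 - x).
  rewrite /F; apply: is_derive_eq.
  by rewrite /GRing.scale /=; lra.
have cF (x : R) : F y @[y --> x] --> F x.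
  by apply: differentiable_continuous; apply/derivable1_diffP; apply: ex_derive.
rewrite (@continuous_FTC2 _ (fun x => 1 - x) F) //.
- by rewrite -EFinD; congr (_%:E); rewrite /F expr0n expr1n /=; lra.
- apply: continuous_subspaceT => x; apply: cvgB; first exact: cvg_cst.
  exact: cvg_id.
- split=> [x _||].
  + exact: ex_derive.
  + by apply: cvg_at_right_filter; exact: cF.
  + by apply: cvg_at_left_filter; exact: cF.
- by move=> x _; rewrite derive1E; apply: derive_val.
Qed.

(** By induction on s: a further set meets the union of the others in a null set. *)
Lemma measure_cover (d : measure_display) (T : measurableType d)
    (m : {measure set T -> \bar R}) (I : eqType) (B : I -> set T) (A : set T)
    (s : seq I) : uniq s -> measurable A -> (forall i, measurable (B i)) ->
  (forall i j, i \in s -> j \in s -> i != j -> m (B i `&` B j) = 0%E) ->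
  A `<=` \big[setU/set0]_(i <- s) B i ->
  m A = (\sum_(i <- s) m (B i `&` A))%E.
Proof.
move=> us mA mB B0 AB.
have mbig (r : seq I) : measurable (\big[setU/set0]_(i <- r) B i).
  by elim/big_ind: _ => //; exact: measurableU.
have null_big i r : i \in s -> {subset r <= s} -> i \notin r ->
    m (\big[setU/set0]_(j <- r) B j `&` B i) = 0%E.
  move=> si; elim: r => [|j r IH] rs; first by rewrite big_nil set0I measure0.
  rewrite inE negb_or => /andP[ij ir]; rewrite big_cons setIUl.
  apply: null_set_setU; try exact: measurableI.
    by apply: B0 => //; [apply: rs; rewrite inE eqxx|rewrite eq_sym].
  by apply: IH => // k kr; apply: rs; rewrite inE kr orbT.
suff cover s' : uniq s' -> {subset s' <= s} ->
    (\sum_(i <- s') m (B i `&` A))%E = m (\big[setU/set0]_(i <- s') B i `&` A).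
  by rewrite cover // setIidr.
elim: s' => [|i s' IH] /=; first by rewrite !big_nil set0I measure0.
move=> /andP[is' us'] ss'; rewrite !big_cons.
have ss : {subset s' <= s} by move=> j js; apply: ss'; rewrite inE js orbT.
have si : i \in s by apply: ss'; rewrite inE eqxx.
rewrite IH //; set C := \big[_/_]_(_ <- _) _.
have mC : measurable C by exact: mbig.
have -> : m (C `&` A) = (m ((C `&` A) `\` B i) + m (C `&` A `&` B i))%E.
  by rewrite -measureDI //; exact: measurableI.
have -> : m (C `&` A `&` B i) = 0%E.
  apply/eqP; rewrite eq_le measure_ge0 andbT -(null_big i s' si ss is').
  apply: le_measure; rewrite ?inE; try by do !apply: measurableI.
  by move=> x [[]].
rewrite adde0 -measureU.
- by congr (m _); apply/seteqP; split=> x /=; [tauto|];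
    case: (pselect (B i x)); tauto.
- exact: measurableI.
- by apply: measurableD => //; exact: measurableI.
- by apply/seteqP; split=> x //= [[Bx _] [_]].
Qed.

End PlaneAndSpaceMeasure.

(** * Barycentric coordinates in a tetrahedral mesh *)

Lemma nbhs_ray (R : realType) (p d : 'rV[R]_3) (U : set 'rV[R]_3) :
  nbhs p U -> exists2 e : R, 0 < e & forall t, `|t| <= e -> U (p + t *: d).
Proof.
move=> nU.
have c : p + t *: d @[t --> (0 : R)] --> p + 0 *: d.
  apply: (@cvgD R _ R (nbhs (0 : R)) _ (fun=> p) (fun t : R => t *: d)).
    exact: cvg_cst.
  by apply: cvgZr_tmp; exact: cvg_id.
rewrite scale0r addr0 in c.
have /nbhs_ballP[e /= e0 eU] := c _ nU.
exists (e / 2); first by rewrite divr_gt0.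
move=> t te; apply: eU; rewrite /ball /= sub0r normrN.
by rewrite (le_lt_trans te) // ltr_pdivrMr // ltr_pMr // ltr1n.
Qed.

Section Geometry.
Variables (R : realType) (M : mesh R).
Local Notation vec := 'rV[R]_3.
Local Notation vid := 'I_(nD M).
Local Notation tid := 'I_(nV M).
Local Notation v := (@vtx R M).
Implicit Types (i j : vid) (k l m : tid) (s T A : {set vid}) (x p q c : vec).

Lemma sum_vecE (w : vid -> R) b :
  dot b (\sum_i w i *: v i) = \sum_i w i * dot b (v i).
Proof. by rewrite dot_sumr; apply: eq_bigr => i _; rewrite dotZr. Qed.

Lemma hull_vtx s i : i \in s -> hull s (v i).
Proof.
move=> si; exists (fun j => (j == i)%:R); split.
- by move=> j; rewrite ler0n.
- by move=> j; case: eqP => // ->; rewrite si.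
- by rewrite (bigD1 i) //= eqxx big1 ?addr0 // => j /negbTE ->.
- rewrite (bigD1 i) //= eqxx scale1r big1 ?addr0 // => j /negbTE ->.
  by rewrite scale0r.
Qed.

Lemma hull_subset s T : s \subset T -> hull (M := M) s `<=` hull T.
Proof.
move=> /fintype.subsetP sT x [w [w0 ws w1 ->]]; exists w; split=> // i iT; apply: ws.
by apply: contra iT; exact: sT.
Qed.

Lemma hull_convex s p q (t : R) : 0 <= t <= 1 -> hull (M := M) s p ->
  hull (M := M) s q -> hull (M := M) s (p + t *: (q - p)).
Proof.
move=> /andP[t0 t1] [wp [wp0 wps wp1 ->]] [wq [wq0 wqs wq1 ->]].
exists (fun i => (1 - t) * wp i + t * wq i); split.
- by move=> i; rewrite addr_ge0 ?mulr_ge0 ?subr_ge0.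
- by move=> i si; rewrite wps // wqs // !mulr0 addr0.
- by rewrite big_split /= -!mulr_sumr wp1 wq1 !mulr1 subrK.
- under [RHS]eq_bigr do rewrite scalerDl -!scalerA.
  rewrite big_split /= -!scaler_sumr scalerBr scalerBl scale1r.
  by rewrite [t *: _ - _]addrC addrA.
Qed.

Section Barycentric.
Variable k : tid.

(** Row i of a vertex of D_k is (1, v i), so that w represents x as an affine
    combination of these vertices if and only if w *m bary_mx = (1, x). *)
Definition bary_mx : 'M[R]_(nD M, 1 + 3) :=
  \matrix_(i < nD M) (if i \in tet k then row_mx 1 (v i) else 0).

Definition bary_cst i : R :=
  if i \in tet k then usubmx (pinvmx bary_mx) 0 i else 0.

Definition bary_grad i : vec :=
  if i \in tet k then \row_j dsubmx (pinvmx bary_mx) j i else 0.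

(** The barycentric coordinate of x at the vertex i of D_k, extended from D_k to an
    affine function on the whole space; it is 0 if i is not a vertex of D_k. *)
Definition bary i x : R := bary_cst i + dot (bary_grad i) x.

Lemma bary_affine i p q (t : R) :
  bary i (p + t *: (q - p)) = bary i p + t * (bary i q - bary i p).
Proof. by rewrite /bary !dotDE; ring. Qed.

Lemma bary_notin i x : i \notin tet k -> bary i x = 0.
Proof.
by move=> /negbTE ik; rewrite /bary /bary_cst /bary_grad ik dot0l addr0.
Qed.

End Barycentric.

Hypothesis DV : delaunay_voronoi_mesh M.

Lemma tet_neq0 k : exists i, i \in tet k.
Proof. by apply/card_gt0P; rewrite (tet_card DV). Qed.

(** The affine form vanishes on D_k, which contains a segment in the direction b. *)
Lemma affine_eq0 k (a : R) (b : vec) :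
  (forall i, i \in tet k -> a + dot b (v i) = 0) -> a = 0 /\ b = 0.
Proof.
move=> ab0.
have D0 x : D k x -> a + dot b x = 0.
  move=> [w [_ wk w1 ->]]; rewrite sum_vecE -[a]mulr1 -w1 mulr_sumr -big_split.
  rewrite big1 //= => i _; rewrite mulrC -mulrDr.
  have [ik|ik] := boolP (i \in tet k); last by rewrite wk // mul0r.
  by rewrite ab0 // mulr0.
have ck := ccenter_interior DV k.
have [e e0 eD] := nbhs_ray b ck.
have b0 : b = 0.
  have De : D k (ccenter k + e *: b) by apply: eD; rewrite ger0_norm ?lexx ?(ltW e0).
  have := D0 _ De; rewrite dotDr dotZr addrA D0; last exact: interior_subset.
  move=> /eqP.
  by rewrite add0r mulf_eq0 gt_eqF //= dot_eq0 => /eqP.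
split=> //; have [i ik] := tet_neq0 k.
by have := ab0 i ik; rewrite b0 dot0l addr0.
Qed.

Lemma bary_mx_notin k i (j : 'I_(1 + 3)) : i \notin tet k -> bary_mx k i j = 0.
Proof. by move=> /negbTE ik; rewrite [LHS]mxE ik mxE. Qed.

Lemma bary_mxl k i : i \in tet k -> bary_mx k i (lshift 3 0) = 1.
Proof. by move=> ik; rewrite [LHS]mxE ik row_mxEl mxE eqxx. Qed.

Lemma bary_mxr k i (j : 'I_3) : i \in tet k -> bary_mx k i (rshift 1 j) = v i 0 j.
Proof. by move=> ik; rewrite [LHS]mxE ik row_mxEr. Qed.

Lemma bary_mx_full k : row_full (bary_mx k).
Proof.
rewrite /row_full -mxrank_tr -/(row_free _); apply: inj_row_free => u uB.
rewrite -[u]hsubmxK in uB *.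
have h i : i \in tet k -> lsubmx u 0 0 + dot (rsubmx u) (v i) = 0.
  move=> ik; have /rowP/(_ i) := uB; rewrite [RHS]mxE [LHS]mxE => <-.
  rewrite big_split_ord /= big_ord1; congr (_ + _).
    by rewrite row_mxEl [_^T _ _]mxE bary_mxl // mulr1.
  by apply: eq_bigr => j _; rewrite row_mxEr [_^T _ _]mxE bary_mxr.
have [a0 b0] := affine_eq0 h.
have -> : lsubmx u = 0 by apply/matrixP => i j; rewrite !ord1 a0 mxE.
by rewrite b0 row_mx0.
Qed.

Lemma bary_spec k x : row_mx 1 x = (\row_i bary k i x) *m bary_mx k.
Proof.
have := mulmxKpV (submx_full (row_mx 1 x : 'rV[R]_(1 + 3)) (bary_mx_full k)).
set P := pinvmx _ => {1}<-.
have E i : i \in tet k -> (row_mx 1 x *m P) 0 i = bary k i x.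
  move=> ik; rewrite -[P]vsubmxK mul_row_col mul1mx mxE /bary /bary_cst.
  rewrite /bary_grad ik -/P; congr (_ + _).
  rewrite mxE; apply: eq_bigr => j _.
  by rewrite [(\row__ _) _ _]mxE mulrC.
apply/rowP => j; rewrite [LHS]mxE [RHS]mxE; apply: eq_bigr => i _.
have [ik|ik] := boolP (i \in tet k); first by rewrite E // [in RHS]mxE.
by rewrite bary_mx_notin // !mulr0.
Qed.

Lemma bary_sum k x : \sum_i bary k i x = 1.
Proof.
have /rowP/(_ (lshift 3 0)) := bary_spec k x.
rewrite row_mxEl => E; transitivity ((1 : 'M[R]_1) 0 0); last by rewrite mxE.
rewrite E [RHS]mxE; apply: eq_bigr => i _.
rewrite [(\row__ _) _ _]mxE.
have [ik|ik] := boolP (i \in tet k); last by rewrite bary_notin ?mul0r.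
by rewrite bary_mxl // mulr1.
Qed.

Lemma bary_pt k x : \sum_i bary k i x *: v i = x.
Proof.
apply/rowP => j; rewrite summxE.
have /rowP/(_ (rshift 1 j)) := bary_spec k x.
rewrite row_mxEr => ->; rewrite [RHS]mxE; apply: eq_bigr => i _.
rewrite [(\row__ _) _ _]mxE [LHS]mxE.
have [ik|ik] := boolP (i \in tet k); last by rewrite bary_notin ?mul0r.
by rewrite bary_mxr.
Qed.

Lemma bary_unique k (w : vid -> R) x :
  (forall i, i \notin tet k -> w i = 0) -> \sum_i w i = 1 ->
  x = \sum_i w i *: v i -> forall i, bary k i x = w i.
Proof.
move=> wk w1 wx i; apply/eqP; rewrite -subr_eq0; apply/eqP.
apply: (tet_affine_indep DV (w := fun i => bary k i x - w i) (k := k)).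
- by move=> j jk; rewrite bary_notin // wk // subrr.
- by rewrite sumrB bary_sum w1 subrr.
under eq_bigr do rewrite scalerBl.
by rewrite sumrB bary_pt -wx subrr.
Qed.

Lemma hull_baryP k s x : s \subset tet k ->
  hull s x <-> (forall i, 0 <= bary k i x) /\ (forall i, i \notin s -> bary k i x = 0).
Proof.
move=> /fintype.subsetP sk; split=> [[w [w0 ws w1 wx]]|[h0 hs]].
  have E : forall i, bary k i x = w i.
    by apply: bary_unique => // i ik; apply: ws; apply: contra ik; exact: sk.
  by split=> i; rewrite E //; exact: ws.
exists (bary k ^~ x); split=> //; first exact: bary_sum.
by rewrite bary_pt.
Qed.

Lemma D_baryP k x : D k x <-> forall i, 0 <= bary k i x.
Proof.
split=> [/(hull_baryP x (subxx _))[]//|h]; apply/hull_baryP => //; split=> // i ik.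
exact: bary_notin.
Qed.

Lemma bary_vtx k i j : j \in tet k -> bary k i (v j) = (i == j)%:R.
Proof.
move=> jk; apply: (bary_unique (w := fun i => (i == j)%:R)).
- by move=> i'; case: eqP => // ->; rewrite jk.
- by rewrite (bigD1 j) //= eqxx big1 ?addr0 // => i' /negbTE ->.
rewrite (bigD1 j) //= eqxx scale1r big1 ?addr0 // => i' /negbTE ->.
by rewrite scale0r.
Qed.

Lemma bary_interior k i c : (D k)° c -> i \in tet k -> 0 < bary k i c.
Proof.
move=> ck ik; have /D_baryP ci := interior_subset ck.
rewrite lt_neqAle ci andbT eq_sym; apply/eqP => c0.
have [e e0 eD] := nbhs_ray (v i - c) ck.
have /eD/D_baryP/(_ i) : `|- e| <= e by rewrite normrN ger0_norm ?lexx ?(ltW e0).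
by rewrite bary_affine c0 bary_vtx // eqxx /= subr0 add0r mulr1 oppr_ge0 leNgt e0.
Qed.

Lemma continuous_bary k i : continuous (bary k i).
Proof. exact: continuous_affine. Qed.

Lemma closed_D k : closed (D k).
Proof.
rewrite (_ : D k = \bigcap_(i in [set: vid]) (bary k i @^-1` [set t | 0 <= t])).
  apply: closed_bigI => i _; apply: closed_comp; last exact: closed_ge.
  by move=> x _; exact: continuous_bary.
apply/seteqP; split=> [x /D_baryP h i _|x h]; first exact: h.
by apply/D_baryP => i; exact: (h i I).
Qed.

Lemma Omega_D x : Omega M x -> exists k, D k x.
Proof. by move=> /interior_subset[k _ Dk]; exists k. Qed.

Lemma open_Omega : open (Omega M).
Proof. exact: open_interior. Qed.

Lemma D_interior_Omega k x : (D k)° x -> Omega M x.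
Proof. by apply: interiorS => y Dy; exists k. Qed.

Lemma Omega_ccenter k : Omega M (ccenter k).
Proof. exact: D_interior_Omega (ccenter_interior DV k). Qed.

(** The segment from x to the circumcenter is in the interior of D_k, except
    possibly for x. *)
Lemma D_closure k : D k `<=` closure (Omega M).
Proof.
move=> x Dx U nU; have [e e0 eU] := nbhs_ray (ccenter k - x) nU.
pose t := Num.min e 1; have t0 : 0 < t by rewrite lt_min e0 ltr01.
exists (x + t *: (ccenter k - x)); split; last first.
  by apply: eU; rewrite ger0_norm ?(ltW t0) // /t ge_min lexx.
apply: (@D_interior_Omega k).
set c := ccenter k; have ck : nbhs c (D k) := ccenter_interior DV k.
(* the homothety of ratio t and center x maps D_k into D_k *)
have : nbhs (x + t *: (c - x)) ((fun y => x + t^-1 *: (y - x)) @^-1` (D k)).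
  have cf (z : vec) : x + t^-1 *: (y - x) @[y --> z] --> x + t^-1 *: (z - x).
    apply: (@cvgD R _ vec (nbhs z) _ (fun=> x) (fun y => t^-1 *: (y - x))).
      exact: cvg_cst.
    apply: cvgZl_tmp.
    by apply: (@cvgB R _ vec (nbhs z) _ id (fun=> x)); [exact: cvg_id|exact: cvg_cst].
  have := cf (x + t *: (c - x)).
  rewrite [x + t *: _ - x]addrAC subrr add0r scalerA mulVf ?gt_eqF // scale1r.
  have -> : x + (c - x) = c by rewrite addrC subrK.
  by apply; exact: ck.
apply: filterS => y /= Dy.
have -> : y = x + t *: ((x + t^-1 *: (y - x)) - x).
  rewrite [x + _ - x]addrAC subrr add0r scalerA divff ?gt_eqF // scale1r.
  by rewrite addrC subrK.
by apply: hull_convex => //; rewrite (ltW t0) /= /t ge_min lexx orbT.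
Qed.

Lemma Omega_of_notbdry k x : D k x -> ~ bdry M x -> Omega M x.
Proof. by move=> /D_closure cx nb; apply: contrapT => nO; apply: nb; split. Qed.

End Geometry.

(** * Stars of interior vertices and edges *)

Lemma bisect_affine (R : realType) (a b p q : 'rV[R]_3) (t : R) :
  bisect a b (p + t *: (q - p)) = bisect a b p + t * (bisect a b q - bisect a b p).
Proof. by rewrite /bisect !dotDE; ring. Qed.

Section Star.
Variables (R : realType) (M : mesh R).
Local Notation vec := 'rV[R]_3.
Local Notation vid := 'I_(nD M).
Local Notation tid := 'I_(nV M).
Local Notation v := (@vtx R M).
Implicit Types (i j : vid) (k l m : tid) (s T A : {set vid}) (x p q c : vec).

(** The relative interior of the simplex with vertex set A. *)
Definition relint A p : Prop :=
  exists w : vid -> R, [/\ forall i, i \in A -> 0 < w i,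
    forall i, i \notin A -> w i = 0, \sum_i w i = 1 & p = \sum_i w i *: v i].

Lemma relint_vtx i : relint [set i]%SET (v i).
Proof.
exists (fun j => (j == i)%:R); split.
- by move=> j; rewrite inE => ->.
- by move=> j; rewrite inE => /negbTE ->.
- by rewrite (bigD1 i) //= eqxx big1 ?addr0 // => j /negbTE ->.
- rewrite (bigD1 i) //= eqxx scale1r big1 ?addr0 // => j /negbTE ->.
  by rewrite scale0r.
Qed.

Lemma relint_hull A p : relint A p -> hull A p.
Proof.
move=> [w [w0 wA w1 ->]]; exists w; split=> // i.
by have [/w0/ltW//|/wA ->] := boolP (i \in A).
Qed.

Lemma relint_perturb A p (U : set vec) : (0 < #|A|)%N -> hull A p -> nbhs p U ->
  exists q, relint A q /\ U q.
Proof.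
move=> A0 [w [w0 wA w1 wp]] nU.
have cA0 : (#|A|%:R : R) != 0 by rewrite pnatr_eq0 -lt0n.
pose u i : R := (i \in A)%:R / #|A|%:R.
have u1 : \sum_i u i = 1.
  rewrite -mulr_suml -natr_sum (_ : (\sum_i _)%N = #|A|) ?divff //.
  by rewrite -sum1_card [RHS]big_mkcond; apply: eq_bigr => i _; case: (i \in A).
pose g := \sum_i u i *: v i.
have [e e0 eU] := nbhs_ray (g - p) nU.
pose t := Num.min e 1; have t0 : 0 < t by rewrite lt_min e0 ltr01.
have t1 : t <= 1 by rewrite ge_min lexx orbT.
exists (p + t *: (g - p)); split; last first.
  by apply: eU; rewrite ger0_norm ?(ltW t0) // /t ge_min lexx.
exists (fun i => (1 - t) * w i + t * u i); split.
- move=> i iA; rewrite ltr_wpDl ?mulr_ge0 ?subr_ge0 // mulr_gt0 //.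
  by rewrite /u iA mul1r invr_gt0 ltr0n.
- by move=> i iA; rewrite wA // /u (negbTE iA) mul0r !mulr0 addr0.
- by rewrite big_split /= -!mulr_sumr w1 u1 !mulr1 subrK.
- under [RHS]eq_bigr do rewrite scalerDl -(scalerA (1 - t)) -(scalerA t).
  rewrite big_split /= -!scaler_sumr scalerBr scalerBl scale1r -wp -/g.
  by rewrite [t *: _ - _]addrC addrA.
Qed.

Hypothesis DV : delaunay_voronoi_mesh M.

Lemma relint_bary k A p : A \subset tet k -> relint A p ->
  (forall i, i \in A -> 0 < bary k i p) /\ (forall i, i \notin A -> bary k i p = 0).
Proof.
move=> /fintype.subsetP Ak [w [w0 wA w1 wp]].
have E i : bary k i p = w i.
  by apply: bary_unique => // j jk; apply: wA; apply: contra jk; exact: Ak.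
by split=> i iA; rewrite E; [exact: w0|exact: wA].
Qed.

(** As the mesh is conforming, p is in the simplex of the common vertices of D_k
    and D_m, and p has positive weight at the vertices in A. *)
Lemma relint_subset k m A p : A \subset tet k -> relint A p -> D m p ->
  A \subset tet m.
Proof.
move=> Ak rp Dm; have Dk : D k p.
  by apply: hull_subset Ak _ _; exact: relint_hull.
have : hull (common k m) p by rewrite -(tet_conforming DV); split.
move=> /(hull_baryP DV _ (finset.subsetIl _ _)) [_ h0].
apply/fintype.subsetP => i iA; have [+ _] := relint_bary Ak rp.
move=> /(_ i iA); apply: contraTT => im; rewrite h0 ?ltxx //.
by rewrite inE negb_and im orbT.
Qed.

Lemma relint_Omega k A : A \subset tet k -> (0 < #|A|)%N ->
  ~ (hull A `<=` bdry M) -> exists p, relint A p /\ Omega M p.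
Proof.
move=> Ak A0 nb.
have [p [hp Op]] : exists p, hull A p /\ Omega M p.
  apply: contrapT => h; apply: nb => p hp; apply: contrapT => nbp; apply: h.
  exists p; split => //; apply: (Omega_of_notbdry DV (k := k)) nbp.
  exact: hull_subset hp.
apply: (relint_perturb A0 hp).
by apply: open_nbhs_nbhs; split; [exact: open_Omega|].
Qed.

(** The tetrahedra that do not contain p are closed, and finite in number. *)
Lemma near_tets p : Omega M p ->
  nbhs p [set q | Omega M q /\ forall m, D m q -> D m p].
Proof.
move=> Op; apply: filterI; first by apply: open_nbhs_nbhs; split; [exact: open_Omega|].
suff h m : nbhs p [set q | D m q -> D m p].
  exact: (@filter_forall _ _ (fun m => [set q | D m q -> D m p]) _ _ h).
have [Dp|nDp] := pselect (D m p); first exact: (filterE _ (fun q _ => Dp)).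
have : nbhs p (~` D m).
  by apply: open_nbhs_nbhs; split => //; apply: closed_openC; exact: closed_D.
by apply: filterS => q nD /nD.
Qed.

(** A point of the segment from p to x that is near p is in Omega, and the
    tetrahedra to which it can belong contain p, hence A. *)
Lemma fan k0 A p x : A \subset tet k0 -> relint A p -> Omega M p ->
  exists2 k, A \subset tet k & forall i, i \notin A -> 0 <= bary k i x.
Proof.
move=> Ak0 rp Op.
have [e e0 eU] := nbhs_ray (x - p) (near_tets Op).
have [|Oq near] := eU e; first by rewrite ger0_norm ?lexx ?(ltW e0).
have [k Dk] := Omega_D Oq.
have Ak : A \subset tet k by apply: relint_subset Ak0 rp _; exact: near.
exists k => // i iA; move/(D_baryP DV): Dk => /(_ i); rewrite bary_affine.
have [_ ->] // := relint_bary Ak rp.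
by rewrite subr0 add0r pmulr_rge0.
Qed.

(** Take q in the relative interior of the face and in Omega, and cross the face at
    q away from the opposite vertex of D_k: the points just beyond are in Omega
    and outside of D_k, and the tetrahedra that contain them contain q. *)
Lemma face_shared s k p : face_of s k -> hull s p -> Omega M p ->
  exists2 m, m != k & s \subset tet m.
Proof.
move=> /andP[/eqP s3 sk] hp Op.
have nO : nbhs p (Omega M) by apply: open_nbhs_nbhs; split; [exact: open_Omega|].
have [q [rq Oq]] : exists q, relint s q /\ Omega M q.
  by apply: relint_perturb hp nO; rewrite s3.
have [j jk js] : exists2 j, j \in tet k & j \notin s.
  apply/subsetPn; apply/negP => /subset_leq_card.
  by rewrite s3 (tet_card DV).
have [e e0 eU] := nbhs_ray (v j - q) (near_tets Oq).
have [|Or near] := eU (- e); first by rewrite normrN ger0_norm ?lexx ?(ltW e0).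
have [m Dm] := Omega_D Or; exists m; last first.
  by apply: relint_subset sk rq _; exact: near.
apply/eqP => mk; move: Dm; rewrite mk => /(D_baryP DV)/(_ j).
rewrite bary_affine (bary_vtx DV) // eqxx; have [_ ->] // := relint_bary sk rq.
by rewrite subr0 add0r mulr1 oppr_ge0 leNgt e0.
Qed.

Lemma common_eq s k m : face_of s k -> m != k -> s \subset tet m ->
  common k m = s.
Proof.
move=> /andP[/eqP s3 sk] mk sm; apply/esym/eqP; rewrite eqEcard s3.
rewrite finset.subsetI sk sm /= leqNgt; apply: contra mk => c4.
apply/eqP; apply: (tet_inj DV); apply/eqP.
have E l : common k m \subset tet l -> common k m = tet l.
  by move=> h; apply/eqP; rewrite eqEcard h (tet_card DV).
by rewrite -(E m) ?finset.subsetIr // -(E k) ?finset.subsetIl.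
Qed.

Lemma ccenter_bisect k i j : i \in tet k -> j \in tet k ->
  bisect (v i) (v j) (ccenter k) = 0.
Proof. by move=> ik jk; apply: enorm_eq_bisect; exact: ccenter_equidistant. Qed.

(** The Voronoi edge of a shared face is orthogonal to it, so that all its points
    are equidistant from the vertices of the face; it meets the face. *)
Lemma face_circumcenter k m : Defs.adjacent k m ->
  exists2 c, hull (common k m) c &
    forall i j, i \in common k m -> j \in common k m -> bisect (v i) (v j) c = 0.
Proof.
move=> km; have [c [[t _ tc] hc]] := voronoi_edge_meets DV km.
exists c => // i j ik jk; have perp := voronoi_edge_perp DV km jk ik.
move: ik jk; rewrite !inE => /andP[ik _] /andP[jk _].
rewrite -tc /bisect dotDr addrA -/(bisect (v i) (v j) (ccenter k)).
rewrite ccenter_bisect // add0r dotZr dotZl [dot (v j - v i) _]dotC.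
by rewrite perp !mulr0.
Qed.

(** T is a vertex, an edge, which contains its midpoint, a face, which is shared
    since it contains p, or the tetrahedron. *)
Lemma circumcenter_in_hull k A p T : hull A p -> Omega M p -> A \subset T ->
  T \subset tet k -> (0 < #|T|)%N ->
  exists2 c, hull T c & forall i j, i \in T -> j \in T -> bisect (v i) (v j) c = 0.
Proof.
move=> hp Op AT Tk T0; have := subset_leq_card Tk; rewrite (tet_card DV) => T4.
have mid i j : bisect (v i) (v j) (v i + 2^-1 *: (v j - v i)) = 0.
  by rewrite /bisect !vecE; lra.
have [T1|T1] := eqVneq #|T| 1%N.
  have /cards1P[i ->] : #|T| == 1%N by rewrite T1.
  exists (v i); first by apply: hull_vtx; rewrite inE.
  by move=> i1 j1; rewrite !inE => /eqP -> /eqP ->; rewrite bisectE subrr.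
have [T2|T2] := eqVneq #|T| 2%N.
  have /cards2P[i [j [ij ->]]] : #|T| == 2%N by rewrite T2.
  exists (v i + 2^-1 *: (v j - v i)).
    apply: hull_convex; first by rewrite invr_ge0 ler0n invf_le1 ?ler1n.
      by apply: hull_vtx; rewrite !inE eqxx.
    by apply: hull_vtx; rewrite !inE eqxx orbT.
  have midC : v i + 2^-1 *: (v j - v i) = v j + 2^-1 *: (v i - v j).
    by apply: vec3P; rewrite !vecE; lra.
  move=> i1 j1; rewrite !inE => /orP[] /eqP -> /orP[] /eqP ->; rewrite ?mid //.
  - by rewrite bisectE subrr.
  - by rewrite midC mid.
  - by rewrite bisectE subrr.
have [T3|T3] := eqVneq #|T| 3%N.
  have fT : face_of T k by rewrite /face_of T3 eqxx.
  have [m mk Tm] := face_shared fT (hull_subset AT hp) Op.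
  have <- := common_eq fT mk Tm; apply: face_circumcenter.
  by rewrite /Defs.adjacent (common_eq fT mk Tm) T3.
have -> : T = tet k.
  apply/eqP; rewrite eqEcard Tk (tet_card DV).
  by move: T0 T1 T2 T3; case: #|T| => [|[|[|[|]]]].
exists (ccenter k); first exact: (interior_subset (ccenter_interior DV k)).
exact: ccenter_bisect.
Qed.

(** In the cone of D_k around its face A, the points of T that are at least as
    close to A as to T lie in T.  Such a point x is on the segment from the
    circumcenter c of T to a point y of the same kind of a face of T that still
    contains A: the ray from c through x meets the same conditions beyond x, and
    it can only remain in the cone for ever if x = c. *)
Lemma voronoi_in_hull k a A T x : a \in A -> A \subset T -> T \subset tet k ->
  (forall T', A \subset T' -> T' \subset T -> exists2 c, hull T' c &
     forall i j, i \in T' -> j \in T' -> bisect (v i) (v j) c = 0) ->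
  (forall i, i \notin A -> 0 <= bary k i x) ->
  (forall i, i \notin T -> bary k i x = 0) ->
  (forall i j, i \in A -> j \in T -> bisect (v i) (v j) x <= 0) ->
  hull T x.
Proof.
move=> aA.
have [n] := ubnP #|T :\: A|; elim: n => // n IH in T x *.
move=> Tn AT Tk cc xA xT xb.
have [c hc cb] := cc T AT (subxx _).
have [c0 cT] := (hull_baryP DV c Tk).1 hc.
have sAT := fintype.subsetP AT.
pose d i := bary k i x - bary k i c.
have [/existsP[j0 Pj0]|] := boolP [exists j in T :\: A, d j < 0]; last first.
  rewrite negb_exists => /forallP d0.
  suff -> : x = c by [].
  apply/eqP; rewrite -subr_eq0 -dot_eq0; apply/eqP/le_anti; rewrite dot_ge0 andbT.
  have E : x - c = \sum_i d i *: v i.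
    under eq_bigr do rewrite scalerBl.
    by rewrite sumrB !(bary_pt DV).
  have d1 : \sum_i d i = 0 by rewrite sumrB !(bary_sum DV) subrr.
  rewrite {2}E sum_vecE.
  have -> : \sum_i d i * dot (x - c) (v i) = \sum_i d i * dot (x - c) (v i - v a).
    under [RHS]eq_bigr do rewrite dotBr mulrBr.
    by rewrite sumrB -mulr_suml d1 mul0r subr0.
  have zb i j : i \in A -> j \in T -> dot (x - c) (v j - v i) <= 0.
    move=> iA jT; have := xb i j iA jT; have := cb i j (sAT i iA) jT.
    rewrite /bisect !dotZl [dot (x - c) _]dotC dotBr; lra.
  apply: sumr_le0 => i _.
  have [iT|iT] := boolP (i \in T); last by rewrite /d xT // cT // subrr mul0r.
  have [iA|iA] := boolP (i \in A).
    have h1 := zb a i aA iT; have h2 := zb i a iA (sAT a aA).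
    rewrite (_ : dot _ _ = 0) ?mulr0 //; apply/le_anti; rewrite h1 /=.
    by rewrite -oppr_le0 -dotNr opprB.
  have di : 0 <= d i by have := d0 i; rewrite !inE iT iA /= -leNgt.
  by rewrite mulr_ge0_le0 // zb.
(* the coordinate at i, if it decreases, vanishes at parameter r i of the ray *)
pose r i := bary k i c / - d i.
have [j Pj jmin] := @arg_minP _ R vid j0 (fun j => (j \in T :\: A) && (d j < 0)) r Pj0.
move: Pj; rewrite finset.in_setD => /andP[/andP[jA jT] dj].
have t1 : 1 <= r j.
  by rewrite /r ler_pdivlMr ?oppr_gt0 // mul1r /d opprB lerBlDr lerDl xA.
have t0 : 0 < r j by exact: lt_le_trans ltr01 t1.
pose y := c + r j *: (x - c).
have yE i : bary k i y = bary k i c + r j * d i by rewrite bary_affine.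
have hy : hull (T :\ j) y.
  apply: IH.
  - apply: (@leq_trans #|T :\: A|); last by rewrite -ltnS.
    rewrite (cardsD1 j (T :\: A)) finset.in_setD jA jT add1n ltnS.
    by apply: eq_leq; apply: eq_card => i; rewrite !inE; case: eqP; rewrite ?andbF.
  - by rewrite subsetD1 AT.
  - by apply: fintype.subset_trans Tk; exact: finset.subsetDl.
  - move=> T' AT' T'T; apply: cc => //; apply: fintype.subset_trans T'T _.
    exact: finset.subsetDl.
  - move=> i iA; rewrite yE; have [iT|iT] := boolP (i \in T); last first.
      by rewrite /d xT // cT // subrr mulr0 addr0.
    have [di|di] := leP 0 (d i).
      exact: addr_ge0 (c0 i) (mulr_ge0 (ltW t0) di).
    have := jmin i; rewrite !inE iT iA di => /(_ isT).
    rewrite {2}/r ler_pdivlMr ?oppr_gt0 // mulrN.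
    by rewrite -subr_ge0 opprK.
  - move=> i; rewrite !inE negb_and negbK yE => /orP[/eqP ->|iT].
      by rewrite /r invrN mulrN mulNr divfK ?subrr // lt_eqF.
    by rewrite /d xT // cT // subrr mulr0 addr0.
  - move=> i i' iA; rewrite !inE => /andP[_ iT].
    rewrite /y bisect_affine cb ?(sAT i) // subr0 add0r.
    by rewrite pmulr_rle0 // xb.
have -> : x = c + (r j)^-1 *: (y - c).
  rewrite /y [c + _ - c]addrAC subrr add0r scalerA mulVf ?gt_eqF // scale1r.
  by rewrite addrC subrK.
apply: hull_convex => //; last by apply: hull_subset hy; exact: finset.subsetDl.
by rewrite invr_ge0 (ltW t0) invf_le1.
Qed.

(** The Voronoi cell of an interior vertex and the Voronoi face of an interior edge
    stay in the star, for A the vertex or the pair of end points of the edge. *)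
Lemma voronoi_in_star k0 A p x : A \subset tet k0 -> (0 < #|A|)%N ->
  relint A p -> Omega M p ->
  (forall i j, i \in A -> bisect (v i) (v j) x <= 0) ->
  exists2 k, A \subset tet k & D k x.
Proof.
move=> Ak0 A0 rp Op xb; have [k Ak xA] := fan x Ak0 rp Op.
exists k => //; have [a aA] := card_gt0P A0.
apply: (voronoi_in_hull (k := k) aA) => //.
- move=> T AT Tk; apply: (circumcenter_in_hull (relint_hull rp) Op AT Tk).
  by apply/card_gt0P; exists a; exact: (fintype.subsetP AT).
- by move=> i ik; exact: bary_notin.
- by move=> i j iA _; exact: xb.
Qed.

Lemma tet_diff k m : k != m -> exists2 i, i \in tet k & i \notin tet m.
Proof.
move=> km; apply/subsetPn; apply: contra km => sub; apply/eqP.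
by apply: (tet_inj DV); apply/eqP; rewrite eqEcard sub !(tet_card DV).
Qed.

Lemma D_overlap k m x i : D k x -> D m x -> i \notin tet m -> bary k i x = 0.
Proof.
move=> Dk Dm im; have : hull (common k m) x by rewrite -(tet_conforming DV).
move=> /(hull_baryP DV _ (finset.subsetIl _ _)) [_]; apply.
by rewrite inE negb_and im orbT.
Qed.

(** A common circumcenter would be an interior point of both tetrahedra, which meet
    only along their boundaries. *)
Lemma ccenter_neq k m : k != m -> ccenter k != ccenter m.
Proof.
move=> km; have [i ik im] := tet_diff km.
have ck := bary_interior DV (ccenter_interior DV k) ik.
apply/eqP => e; move: ck; rewrite (D_overlap (m := m)) ?ltxx //.
  exact: interior_subset (ccenter_interior DV k).
by rewrite e; exact: interior_subset (ccenter_interior DV m).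
Qed.

Lemma adjacent_neq k m : Defs.adjacent k m -> k != m.
Proof.
by apply: contraTneq => ->; rewrite /Defs.adjacent /common finset.setIid (tet_card DV).
Qed.

Lemma Omega_vtx i : ~ bdry M (v i) -> Omega M (v i).
Proof.
move=> nb; have [k ik] := vtx_used DV i.
by apply: (Omega_of_notbdry DV (k := k)) nb; exact: hull_vtx.
Qed.

End Star.

(** * Areas and volumes of the dual mesh *)

Section Parametrizations.
Variable R : realType.
Local Notation vec := 'rV[R]_3.
Local Notation mR := (measurableTypeR R).

Definition space_pt (t : R * (R * R)) : vec := \row_(i < 3) [:: t.1; t.2.1; t.2.2]`_i.

Lemma volumeE (A : set vec) : volume A = fine (lebesgue3 R (space_pt @^-1` A)).
Proof. by []. Qed.

Lemma areaE (c : chart R) (A : set vec) :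
  area c A = enorm (cross c.1.2 c.2) * fine (lebesgue2 R (chart_pt c @^-1` A)).
Proof. by []. Qed.

Lemma space_pt0 t : space_pt t 0 0 = t.1.
Proof. by rewrite mxE. Qed.

Lemma space_pt1 t : space_pt t 0 1 = t.2.1.
Proof. by rewrite mxE. Qed.

Lemma space_pt2 t : space_pt t 0 2%:R = t.2.2.
Proof. by rewrite mxE. Qed.

Definition space_coord (x : vec) : R * (R * R) := (x 0 0, (x 0 1, x 0 2%:R)).

Lemma space_coordK x : space_pt (space_coord x) = x.
Proof. by apply: vec3P; rewrite ?space_pt0 ?space_pt1 ?space_pt2. Qed.

Lemma dot_space_pt b t :
  dot b (space_pt t) = b 0 0 * t.1 + b 0 1 * t.2.1 + b 0 2%:R * t.2.2.
Proof. by rewrite dotE space_pt0 space_pt1 space_pt2. Qed.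

Lemma continuous_space_pt : continuous space_pt.
Proof.
pose e (i : 'I_3) : vec := delta_mx 0 i.
have -> : space_pt = fun t => t.1 *: e 0 + t.2.1 *: e 1 + t.2.2 *: e 2%:R.
  apply/funext => t; apply: vec3P; rewrite ?space_pt0 ?space_pt1 ?space_pt2;
  by rewrite !mxE /= ?mulr1 ?mulr0 ?addr0 ?add0r.
move=> t.
have c2 : (fun t : R * (R * R) => t.2) @ t --> t.2 by exact: cvg_snd.
have c1 : (fun t : R * (R * R) => t.1) @ t --> t.1 by exact: cvg_fst.
have c21 : (fun t : R * (R * R) => t.2.1) @ t --> t.2.1.
  by apply: (cvg_comp _ _ c2); exact: cvg_fst.
have c22 : (fun t : R * (R * R) => t.2.2) @ t --> t.2.2.
  by apply: (cvg_comp _ _ c2); exact: cvg_snd.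
exact: (cvgD (cvgD (cvgZr_tmp c1) (cvgZr_tmp c21)) (cvgZr_tmp c22)).
Qed.

Lemma dot_chart_pt b (c : chart R) t :
  dot b (chart_pt c t) = dot b c.1.1 + dot b c.1.2 * t.1 + dot b c.2 * t.2.
Proof. by rewrite /chart_pt !dotDr !dotZr; ring. Qed.

Lemma continuous_chart_pt (c : chart R) : continuous (chart_pt c).
Proof.
move=> t.
have c1 : (fun t : R * R => t.1) @ t --> t.1 by exact: cvg_fst.
have c2 : (fun t : R * R => t.2) @ t --> t.2 by exact: cvg_snd.
exact: (cvgD (cvgD (cvg_cst _) (cvgZr_tmp c1)) (cvgZr_tmp c2)).
Qed.

Lemma space_open_measurable (U : set vec) : open U ->
  measurable (space_pt @^-1` U : set (mR * (mR * mR))).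
Proof.
move=> oU; apply: open_measurable3; apply: open_comp => // t _.
exact: continuous_space_pt.
Qed.

Lemma space_closed_measurable (U : set vec) : closed U ->
  measurable (space_pt @^-1` U : set (mR * (mR * mR))).
Proof.
move=> oU; apply: closed_measurable3; apply: closed_comp => // t _.
exact: continuous_space_pt.
Qed.

Lemma chart_open_measurable c (U : set vec) : open U ->
  measurable (chart_pt c @^-1` U : set (mR * mR)).
Proof.
move=> oU; apply: open_measurable2; apply: open_comp => // t _.
exact: continuous_chart_pt.
Qed.

Lemma chart_closed_measurable c (U : set vec) : closed U ->
  measurable (chart_pt c @^-1` U : set (mR * mR)).
Proof.
move=> oU; apply: closed_measurable2; apply: closed_comp => // t _.
exact: continuous_chart_pt.
Qed.

(** The coordinates in the chart are affine functions, with gradients the dual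
    basis of u, w in their plane up to the factor |u x w|^2. *)
Lemma chart_pt_bounded (c : chart R) (r : R) : cross c.1.2 c.2 != 0 ->
  exists r' : R, forall t, (forall i, `|chart_pt c t 0 i| <= r) ->
    `|t.1| <= r' /\ `|t.2| <= r'.
Proof.
case: c => [[p u] w] /=; set n := cross u w => n0.
have nn : 0 < dot n n by exact: dot_gt0.
pose N (b : vec) : R := `|b 0 0| + `|b 0 1| + `|b 0 2%:R|.
have N0 b : 0 <= N b by rewrite !addr_ge0.
have dotN (b x : vec) (s : R) : (forall i, `|x 0 i| <= s) -> `|dot b x| <= N b * s.
  move=> xs; rewrite dotE /N !mulrDl; apply: le_trans (ler_normD _ _) _.
  apply: lerD; last by rewrite normrM ler_wpM2l.
  apply: le_trans (ler_normD _ _) _.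
  by apply: lerD; rewrite normrM ler_wpM2l.
pose b1 := cross w n; pose b2 := cross n u.
have E1 (s t : R) : dot b1 (p + s *: u + t *: w) = dot b1 p + s * dot n n.
  by rewrite /b1 /n !vecE; ring.
have E2 (s t : R) : dot b2 (p + s *: u + t *: w) = dot b2 p + t * dot n n.
  by rewrite /b2 /n !vecE; ring.
exists (((N b1 + N b2) * `|r| + `|dot b1 p| + `|dot b2 p|) / dot n n) => -[s t] h.
have h' i : `|chart_pt (p, u, w) (s, t) 0 i| <= `|r|.
  exact: le_trans (h i) (ler_norm _).
have := dotN b1 _ _ h'; have := dotN b2 _ _ h'.
rewrite /chart_pt /= E1 E2 => h2 h1; rewrite !ler_pdivlMr //.
rewrite -{1 2}(gtr0_norm nn) -!normrM.
have nr : 0 <= `|r| by [].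
have m1 := mulr_ge0 (N0 b1) nr; have m2 := mulr_ge0 (N0 b2) nr.
have k1 := normr_ge0 (dot b1 p); have k2 := normr_ge0 (dot b2 p).
split.
  have -> : s * dot n n = (dot b1 p + s * dot n n) - dot b1 p by ring.
  apply: le_trans (ler_normB _ _) _; lra.
have -> : t * dot n n = (dot b2 p + t * dot n n) - dot b2 p by ring.
apply: le_trans (ler_normB _ _) _; lra.
Qed.

Lemma fine_sum (I : Type) (s : seq I) (f : I -> \bar R) :
  (forall i, f i \is a fin_num) ->
  fine (\sum_(i <- s) f i)%E = \sum_(i <- s) fine (f i).
Proof.
move=> ff; rewrite (eq_bigr (fun i => (fine (f i))%:E)) ?sumEFin //.
by move=> i _; rewrite fineK.
Qed.

End Parametrizations.

Section Cells.
Variables (R : realType) (M : mesh R).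
Hypothesis DV : delaunay_voronoi_mesh M.
Local Notation vec := 'rV[R]_3.
Local Notation mR := (measurableTypeR R).
Local Notation vid := 'I_(nD M).
Local Notation tid := 'I_(nV M).
Local Notation v := (@vtx R M).
Implicit Types (i j : vid) (k l m : tid) (s T A : {set vid}) (x p q c : vec)
  (e : vid * vid).

Lemma cellE i : cell i = Omega M `&` [set x | forall j, bisect (v i) (v j) x <= 0].
Proof.
apply/seteqP; split=> x [Ox h]; split=> // j; last by rewrite enorm_le_bisect.
have [->|ji] := eqVneq j i; first by rewrite bisectE subrr.
by rewrite -enorm_le_bisect h.
Qed.

Lemma closed_bisect p q : closed [set x | bisect p q x <= 0].
Proof.
apply: (@closed_comp _ _ (bisect p q) [set t | t <= 0]); last exact: closed_le.
by move=> x _; exact: continuous_affine.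
Qed.

Lemma closed_half_spaces i : closed [set x | forall j, bisect (v i) (v j) x <= 0].
Proof.
rewrite (_ : [set x | _] = \bigcap_(j in [set: vid]) [set x | bisect (v i) (v j) x <= 0]).
  by apply: closed_bigI => j _; exact: closed_bisect.
by apply/seteqP; split=> x h j => [_|]; exact: h.
Qed.

Lemma Omega_bounded : exists r : R, forall x, Omega M x ->
  forall i : 'I_3, `|x 0 i| <= r.
Proof.
exists (\sum_j \sum_i `|v j 0 i|) => x /Omega_D[k [w [w0 _ w1 ->]]] i.
rewrite summxE; apply: le_trans (ler_norm_sum _ _ _) _; apply: ler_sum => j _.
rewrite mxE normrM ger0_norm //.
have wj : w j <= 1 by rewrite -w1 (bigD1 j) //= lerDl sumr_ge0.
apply: (@le_trans _ _ `|v j 0 i|); first by rewrite ler_piMl.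
by rewrite (bigD1 i) //= lerDl sumr_ge0.
Qed.

Lemma cell_measurable3 i : measurable (@space_pt R @^-1` cell i : set (mR * (mR * mR))).
Proof.
rewrite cellE preimage_setI; apply: measurableI.
  by apply: space_open_measurable; exact: open_Omega.
by apply: space_closed_measurable; exact: closed_half_spaces.
Qed.

Lemma D_measurable3 k : measurable (@space_pt R @^-1` D k : set (mR * (mR * mR))).
Proof. by apply: space_closed_measurable; exact: closed_D. Qed.

Lemma cell_finite i (B : set (mR * (mR * mR))) : measurable B ->
  lebesgue3 R (B `&` @space_pt R @^-1` cell i) \is a fin_num.
Proof.
move=> mB; rewrite ge0_fin_numE //; have [r Or] := Omega_bounded.
apply: (@measure3_bounded R _ r).
  by apply: measurableI => //; exact: cell_measurable3.
move=> t [_ /=]; rewrite cellE => -[/Or h _].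
by have := h 0; have := h 1; have := h 2%:R; rewrite space_pt0 space_pt1 space_pt2.
Qed.

Lemma bary_grad_neq0 k i : i \in tet k -> bary_grad k i != 0.
Proof.
move=> ik; have [j jk ji] : exists2 j, j \in tet k & j \notin [set i]%SET.
  apply/subsetPn; apply/negP => /subset_leq_card.
  by rewrite cards1 (tet_card DV).
apply/eqP => g0; have := bary_vtx DV i jk; have := bary_vtx DV i ik.
rewrite inE eq_sym in ji.
by rewrite /bary g0 !dot0l (negbTE ji) eqxx => -> /eqP; rewrite oner_eq0.
Qed.

Lemma D_overlap_null3 k l : k != l ->
  lebesgue3 R (@space_pt R @^-1` D k `&` @space_pt R @^-1` D l) = 0%E.
Proof.
move=> kl; have [i ik il] := tet_diff DV kl.
apply/eqP; rewrite eq_le measure_ge0 andbT.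
set g := bary_grad k i.
have <- : lebesgue3 R [set t : mR * (mR * mR) |
    bary_cst k i + g 0 0 * t.1 + g 0 1 * t.2.1 + g 0 2%:R * t.2.2 = 0] = 0%E.
  apply: plane_null; have := bary_grad_neq0 ik; rewrite -/g; apply: contraR.
  rewrite !negb_or !negbK => /and3P[/eqP g0 /eqP g1 /eqP g2].
  by apply/eqP; apply: vec3P; rewrite mxE.
apply: le_lebesgue3; first by apply: measurableI; exact: D_measurable3.
  exact: affine3_measurable.
move=> t [/= Dk Dl]; have := D_overlap DV Dk Dl il.
by rewrite /bary dot_space_pt !addrA.
Qed.

Lemma cell_in_star i x : Omega M (v i) -> cell i x ->
  exists2 l, i \in tet l & D l x.
Proof.
rewrite cellE => Oi [_ h]; have [k0 ik0] := vtx_used DV i.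
have [||i' j|l] := @voronoi_in_star R M DV k0 [set i]%SET (v i) x _ _ (relint_vtx i) Oi.
- by rewrite finset.sub1set.
- by rewrite cards1.
- by rewrite inE => /eqP ->.
by rewrite finset.sub1set => il Dl; exists l.
Qed.

(** The star of i covers the cell, and the overlaps of the tetrahedra are in
    planes. *)
Lemma volume_cell i : Omega M (v i) ->
  volume (cell i) = \sum_(l | i \in tet l) volume (D l `&` cell i).
Proof.
move=> Oi; rewrite volumeE.
rewrite (@measure_cover _ _ _ (lebesgue3 R) _ (fun l => @space_pt R @^-1` D l)
  (@space_pt R @^-1` cell i) (enum [set l | i \in tet l]%SET)).
- rewrite fine_sum; last by move=> l; apply: cell_finite; exact: D_measurable3.
  rewrite big_enum /=; apply: eq_big => [l|l _]; first by rewrite inE.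
  by rewrite volumeE preimage_setI.
- exact: enum_uniq.
- exact: cell_measurable3.
- exact: D_measurable3.
- by move=> k l _ _; exact: D_overlap_null3.
move=> t /= /(cell_in_star Oi)[l il Dl]; rewrite -bigcup_seq.
by exists l => //=; rewrite mem_enum inE.
Qed.

Lemma nbhs_bisect_lt p q x : bisect p q x < 0 -> nbhs x [set y | bisect p q y < 0].
Proof.
move=> h; apply: open_nbhs_nbhs; split => //.
apply: (@open_comp _ _ (bisect p q) [set t | t < 0]); last exact: open_lt.
by move=> y _; exact: continuous_affine.
Qed.

Lemma volume_cell_gt0 i : Omega M (v i) -> 0 < volume (cell i).
Proof.
move=> Oi; rewrite volumeE.
have := cell_finite i (@measurableT _ (mR * (mR * mR))%type); rewrite setTI => fin.
apply: fine_gt0; rewrite -ge0_fin_numE // fin andbT.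
apply: (@measure3_open_gt0 _ _ (space_coord (v i))); last exact: cell_measurable3.
apply: continuous_space_pt; rewrite space_coordK cellE; apply: filterI.
  by apply: open_nbhs_nbhs; split; [exact: open_Omega|].
suff h j : nbhs (v i) [set x | bisect (v i) (v j) x <= 0].
  exact: (@filter_forall _ _ (fun j => [set x | bisect (v i) (v j) x <= 0]) _ _ h).
have [->|ji] := eqVneq j i; first by apply: filterE => x; rewrite /= bisectE subrr.
have ij : bisect (v i) (v j) (v i) < 0.
  rewrite bisectE subrr dot0l sub0r oppr_lt0 dot_gt0 // subr_eq0.
  by apply: contra ji => /eqP/(vtx_inj DV) ->.
by apply: filterS (nbhs_bisect_lt ij) => x /ltW.
Qed.

Section VoronoiFace.
Variable e : vid * vid.
Hypotheses (e12 : e.1 != e.2).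

Let d : vec := v e.2 - v e.1.
Let c : chart R := voronoi_chart e.

Lemma edge_vec_neq0 : v e.2 - v e.1 != 0.
Proof. by rewrite subr_eq0; apply: contra e12 => /eqP/(vtx_inj DV) ->. Qed.

Lemma voronoi_chart_frame :
  [/\ dot d c.1.2 = 0, dot d c.2 = 0 & cross c.1.2 c.2 != 0].
Proof.
have [h1 h2 h3] := normal_frameP edge_vec_neq0.
by split; rewrite ?[dot d _]dotC.
Qed.

Lemma voronoi_chart_bisect t : bisect (v e.1) (v e.2) (chart_pt c t) = 0.
Proof.
have [h1 h2 _] := voronoi_chart_frame.
rewrite /bisect dot_chart_pt !dotZl -/d h1 h2 /c /= /d !vecE; lra.
Qed.

Lemma voronoi_chart_onto x : bisect (v e.1) (v e.2) x = 0 ->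
  exists t, chart_pt c t = x.
Proof.
move=> h; have [h1 h2 h3] := voronoi_chart_frame.
have dx : dot d (x - c.1.1) = 0.
  by move: h; rewrite /bisect /c /= /d !vecE => h; lra.
have [s [t st]] := span2 h3 edge_vec_neq0 h1 h2 dx.
by exists (s, t); rewrite /chart_pt /= -addrA -st addrC subrK.
Qed.

Lemma voronoi_face_measurable :
  measurable (chart_pt c @^-1` voronoi_face e : set (mR * mR)).
Proof.
rewrite /voronoi_face !cellE !preimage_setI.
have mO : measurable (chart_pt c @^-1` Omega M : set (mR * mR)).
  by apply: chart_open_measurable; exact: open_Omega.
have mH i : measurable (chart_pt c @^-1`
    [set x | forall j, bisect (v i) (v j) x <= 0] : set (mR * mR)).
  by apply: chart_closed_measurable; exact: closed_half_spaces.
by apply: measurableI; apply: measurableI.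
Qed.

Lemma D_measurable2 k : measurable (chart_pt c @^-1` D k : set (mR * mR)).
Proof. by apply: chart_closed_measurable; exact: closed_D. Qed.

Lemma voronoi_face_finite (B : set (mR * mR)) : measurable B ->
  lebesgue2 R (B `&` chart_pt c @^-1` voronoi_face e) \is a fin_num.
Proof.
move=> mB; rewrite ge0_fin_numE //; have [r Or] := Omega_bounded.
have [_ _ h3] := voronoi_chart_frame.
have [r' rr] := chart_pt_bounded r h3.
apply: (@measure2_bounded R _ r').
  by apply: measurableI => //; exact: voronoi_face_measurable.
by move=> t [_ /= [[/Or h _] _]]; exact: rr.
Qed.

(** The plane of a face of D_k that contains their overlap is parallel to the edge,
    so it meets the bisecting plane of the edge in a line. *)
Lemma D_overlap_null2 k l : verts e \subset tet k -> verts e \subset tet l ->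
  k != l ->
  lebesgue2 R (chart_pt c @^-1` D k `&` chart_pt c @^-1` D l) = 0%E.
Proof.
move=> ek el kl; have [i ik il] := tet_diff DV kl.
apply/eqP; rewrite eq_le measure_ge0 andbT.
set g := bary_grad k i; have [h1 h2 h3] := voronoi_chart_frame.
have <- : lebesgue2 R [set t : mR * mR |
    (bary_cst k i + dot g c.1.1) + dot g c.1.2 * t.1 + dot g c.2 * t.2 = 0] = 0%E.
  apply: line_null; have := bary_grad_neq0 ik; rewrite -/g; apply: contraR.
  rewrite negb_or !negbK => /andP[/eqP g1 /eqP g2].
  apply/eqP; apply: (orth3_eq0 h3 edge_vec_neq0 h1 h2 g1 g2).
  have ev j : j \in verts e -> bary k i (v j) = 0.
    move=> je; rewrite (bary_vtx DV); last exact: (fintype.subsetP ek).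
    by case: eqP => // ij; move: il; rewrite ij (fintype.subsetP el).
  have b1 := ev e.1; have b2 := ev e.2; move: b1 b2.
  rewrite !inE !eqxx orbT => /(_ isT) b1 /(_ isT) b2.
  rewrite dotBr; move: b1 b2; rewrite /bary -/g; lra.
apply: le_lebesgue2; first by apply: measurableI; exact: D_measurable2.
  exact: affine2_measurable.
move=> t [/= Dk Dl]; have := D_overlap DV Dk Dl il.
by rewrite /bary dot_chart_pt !addrA.
Qed.

Lemma voronoi_face_bisect x : voronoi_face e x ->
  forall i j, i \in verts e -> bisect (v i) (v j) x <= 0.
Proof.
rewrite /voronoi_face !cellE => -[[_ h1] [_ h2]] i j.
by rewrite !inE => /orP[] /eqP ->; [exact: h1|exact: h2].
Qed.

Hypothesis e_int : ~ (hull (verts e) `<=` bdry M).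
Variable k0 : tid.
Hypothesis ek0 : verts e \subset tet k0.

Let e2 : #|verts e| = 2%N. Proof. by rewrite cards2 e12. Qed.

(** The star of the edge covers its Voronoi face, and the overlaps of these
    tetrahedra are on lines. *)
Lemma voronoi_face_area_sum :
  voronoi_face_area e = \sum_(l | verts e \subset tet l) voronoi_face_area_in e (D l).
Proof.
have [p [rp Op]] : exists p, relint (verts e) p /\ Omega M p.
  by apply: (relint_Omega DV ek0) => //; rewrite e2.
rewrite /voronoi_face_area /voronoi_face_area_in areaE.
rewrite (@measure_cover _ _ _ (lebesgue2 R) _ (fun l => chart_pt c @^-1` D l)
  (chart_pt c @^-1` voronoi_face e)
  (enum [set l | verts e \subset tet l]%SET)).
- rewrite fine_sum; last by move=> l; apply: voronoi_face_finite; exact: D_measurable2.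
  rewrite mulr_sumr big_enum /=; apply: eq_big => [l|l _]; first by rewrite inE.
  by rewrite areaE preimage_setI setIC.
- exact: enum_uniq.
- exact: voronoi_face_measurable.
- exact: D_measurable2.
- by move=> k l; rewrite !mem_enum !inE; exact: D_overlap_null2.
move=> t /= /voronoi_face_bisect xb.
have [|l el Dl] := @voronoi_in_star R M DV k0 (verts e) p (chart_pt c t) ek0 _ rp Op xb.
  by rewrite e2.
by rewrite -bigcup_seq; exists l => //=; rewrite mem_enum inE.
Qed.

(** The faces of D_k0 at the edge are shared with two tetrahedra; the
    circumcenters of the three are not collinear, since the dual edges that join
    them are orthogonal to two different planes. *)
Lemma voronoi_face_triangle : exists k1 k2 : tid,
  [/\ verts e \subset tet k1, verts e \subset tet k2 &
      cross (ccenter k1 - ccenter k0) (ccenter k2 - ccenter k0) != 0].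
Proof.
have [p [rp Op]] : exists p, relint (verts e) p /\ Omega M p.
  by apply: (relint_Omega DV ek0) => //; rewrite e2.
have nb a : a \in tet k0 -> a \notin verts e -> exists m : tid,
    [/\ verts e \subset tet m, ccenter m != ccenter k0 &
      forall i, i \in a |: verts e -> dot (ccenter m - ccenter k0) (v i - v e.1) = 0].
  move=> ak ae.
  have f : face_of (a |: verts e) k0.
    by rewrite /face_of cardsU1 ae e2 /= finset.subUset finset.sub1set ak ek0.
  have hp : hull (a |: verts e) p.
    by apply: (hull_subset (finset.subsetUr _ _)); exact: relint_hull.
  have [m mk sm] := face_shared DV f hp Op; exists m; split.
  - by apply: fintype.subset_trans sm; exact: finset.subsetUr.
  - exact: ccenter_neq.
  - have cm := common_eq DV f mk sm => i ia.
    have km : Defs.adjacent k0 m by rewrite /Defs.adjacent cm; case/andP: f.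
    apply: (voronoi_edge_perp DV km); rewrite cm // !inE eqxx /=.
    by rewrite orbT.
have /eqP/cards2P[a [b [ab E]]] : #|tet k0 :\: verts e| = 2%N.
  have := cardsID (verts e) (tet k0); rewrite (tet_card DV) (finset.setIidPr ek0) e2.
  by move=> /eqP; rewrite -[4%N]/(2 + 2)%N eqn_add2l => /eqP.
have : a \in tet k0 :\: verts e by rewrite E !inE eqxx.
rewrite finset.in_setD => /andP[ae ak].
have : b \in tet k0 :\: verts e by rewrite E !inE eqxx orbT.
rewrite finset.in_setD => /andP[be bk].
have [k1 [ek1 c1 p1]] := nb a ak ae; have [k2 [ek2 c2 p2]] := nb b bk be.
exists k1, k2; split=> //; apply/eqP => u0.
set u := ccenter k1 - ccenter k0 in u0 p1; set w := ccenter k2 - ccenter k0 in u0 p2.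
have un0 : u != 0 by rewrite subr_eq0.
have wn0 : w != 0 by rewrite subr_eq0.
have uu : dot u u != 0 by rewrite dot_eq0.
have wu : dot u u *: w = dot u w *: u.
  have := cross_cross u u w; rewrite u0 (_ : cross u 0 = 0); last first.
    by apply: vec3P; rewrite !vecE; ring.
  by move=> /esym/eqP; rewrite subr_eq0 => /eqP.
have uw : dot u w != 0.
  apply: contraNneq wn0 => h; move/eqP: wu; rewrite h scale0r scaler_eq0.
  by rewrite (negbTE uu).
have ub : dot u (v b - v e.1) = 0.
  have : dot (dot u u *: w) (v b - v e.1) = 0.
    by rewrite dotZl p2 ?mulr0 // !inE eqxx.
  by rewrite wu dotZl => /eqP; rewrite mulf_eq0 (negbTE uw) => /eqP.
have ui i : i \in tet k0 -> - dot u (v e.1) + dot u (v i) = 0.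
  move=> ik; rewrite addrC -dotBr; have [ie|ie] := boolP (i \in verts e).
    by rewrite p1 // inE ie orbT.
  have : i \in tet k0 :\: verts e by rewrite finset.in_setD ie ik.
  rewrite E !inE => /orP[] /eqP -> //; by rewrite p1 // !inE eqxx.
by have [_ /eqP] := affine_eq0 DV ui; rewrite (negbTE un0).
Qed.

(** A point z in the triangle of the three circumcenters that is close enough to
    the first one to be in Omega is in the relative interior of the Voronoi face.
    Otherwise a vertex j outside of e is at the same distance as e.1 from all three
    centers; then it is on the line of the edge and on a sphere that passes through
    the end points, so it is one of them. *)
Lemma voronoi_face_area_gt0 : 0 < voronoi_face_area e.
Proof.
have [k1 [k2 [ek1 ek2 n0]]] := voronoi_face_triangle.
have [h1 h2 h3] := voronoi_chart_frame.
rewrite /voronoi_face_area areaE -/c mulr_gt0 ?enorm_gt0 //.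
have := voronoi_face_finite (@measurableT _ (mR * mR)%type); rewrite setTI => fin.
apply: fine_gt0; rewrite -ge0_fin_numE // fin andbT.
pose z0 := ccenter k0; pose u := ccenter k1 - z0; pose w := ccenter k2 - z0.
have [r r0 rO] : exists2 r, 0 < r & forall t, `|t| <= r -> Omega M (z0 + t *: (u + w)).
  apply: nbhs_ray; apply: open_nbhs_nbhs; split; first exact: open_Omega.
  exact: Omega_ccenter.
(* then z below has positive weights 1 - 2 t, t and t *)
pose t := Num.min r 4^-1; have t0 : 0 < t by rewrite lt_min r0 invr_gt0 ltr0n.
have t4 : t <= 4^-1 by rewrite ge_min lexx orbT.
pose z := z0 + t *: (u + w).
have Oz : Omega M z by apply: rO; rewrite ger0_norm ?(ltW t0) // /t ge_min lexx.
have zb p q : bisect p q z = (1 - 2 * t) * bisect p q z0 +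
    t * bisect p q (ccenter k1) + t * bisect p q (ccenter k2).
  by rewrite /z /u /w /bisect !dotDE; ring.
have cb k i j : i \in tet k -> bisect (v i) (v j) (ccenter k) <= 0.
  by move=> ik; rewrite -enorm_le_bisect; exact: empty_circumball.
have ev1 k : verts e \subset tet k -> e.1 \in tet k.
  by move=> /fintype.subsetP; apply; rewrite !inE eqxx.
have ev2 k : verts e \subset tet k -> e.2 \in tet k.
  by move=> /fintype.subsetP; apply; rewrite !inE eqxx orbT.
have cc k : verts e \subset tet k -> bisect (v e.1) (v e.2) (ccenter k) = 0.
  by move=> ek; apply: ccenter_bisect; [|exact: ev1|exact: ev2].
have z12 : bisect (v e.1) (v e.2) z = 0 by rewrite zb !cc // !mulr0 !addr0.
have [t' tz] := voronoi_chart_onto z12.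
have strict j : j \notin verts e -> bisect (v e.1) (v j) z < 0.
  move=> je; rewrite zb.
  have l0 := cb k0 e.1 j (ev1 _ ek0); have l1 := cb k1 e.1 j (ev1 _ ek1).
  have l2 := cb k2 e.1 j (ev1 _ ek2).
  rewrite ltNge; apply/negP => ge.
  have m0 : (1 - 2 * t) * bisect (v e.1) (v j) z0 <= 0 by rewrite mulr_ge0_le0 //; lra.
  have m1 := mulr_ge0_le0 (ltW t0) l1; have m2 := mulr_ge0_le0 (ltW t0) l2.
  have q0 : bisect (v e.1) (v j) z0 = 0.
    have : (1 - 2 * t) * bisect (v e.1) (v j) z0 = 0 by lra.
    by move=> /eqP; rewrite mulf_eq0 => /orP[/eqP|/eqP//]; lra.
  have q1 : bisect (v e.1) (v j) (ccenter k1) = 0.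
    have : t * bisect (v e.1) (v j) (ccenter k1) = 0 by lra.
    by move=> /eqP; rewrite mulf_eq0 gt_eqF //= => /eqP.
  have q2 : bisect (v e.1) (v j) (ccenter k2) = 0.
    have : t * bisect (v e.1) (v j) (ccenter k2) = 0 by lra.
    by move=> /eqP; rewrite mulf_eq0 gt_eqF //= => /eqP.
  pose y := v j - v e.1.
  have yu : dot y u = 0 by move: q0 q1; rewrite /bisect !dotZl -/y /u dotBr; lra.
  have yw : dot y w = 0 by move: q0 q2; rewrite /bisect !dotZl -/y /w dotBr; lra.
  have du : dot d u = 0.
    by move: (cc k0 ek0) (cc k1 ek1); rewrite /bisect !dotZl -/d /u dotBr -/z0; lra.
  have dw : dot d w = 0.
    by move: (cc k0 ek0) (cc k2 ek2); rewrite /bisect !dotZl -/d /w dotBr -/z0; lra.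
  have [s ys] : exists s : R, y = s *: d.
    have [a da] : exists a, d = a *: cross u w by eexists; exact: orth2_colinear.
    have [b yb] : exists b, y = b *: cross u w by eexists; exact: orth2_colinear.
    have a0 : a != 0.
      by apply: contraNneq edge_vec_neq0 => a0; rewrite -/d da a0 scale0r.
    by exists (b / a); rewrite yb da scalerA divfK.
  (* v e.1, v e.2 and v j are collinear points of a sphere *)
  have := cc k0 ek0; have := q0; rewrite !bisectE -/z0.
  have -> : z0 - v j = (z0 - v e.1) - s *: d.
    by rewrite -ys /y opprB addrA subrK.
  have -> : z0 - v e.2 = (z0 - v e.1) - d by rewrite /d opprB addrA subrK.
  move=> E1 E2; have [s0|s1] := line_sphere edge_vec_neq0 E1 E2;
    move: je; rewrite !inE negb_or => /andP[/eqP j1 /eqP j2].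
    apply: j1; apply: (vtx_inj DV); apply/eqP; rewrite -subr_eq0 -/y ys s0.
    by rewrite scale0r.
  apply: j2; apply: (vtx_inj DV); apply/eqP; rewrite -subr_eq0.
  by rewrite -(subrKA (v e.1)) -/y ys s1 scale1r /d subrKA subrr.
apply: (@measure2_open_gt0 _ _ t'); last exact: voronoi_face_measurable.
have near : nbhs z [set x | Omega M x /\
    forall j, j \notin verts e -> bisect (v e.1) (v j) x < 0].
  apply: filterI; first by apply: open_nbhs_nbhs; split; [exact: open_Omega|].
  suff h j : nbhs z [set x | j \notin verts e -> bisect (v e.1) (v j) x < 0].
    exact: (@filter_forall _ _ (fun j => [set x | j \notin verts e -> _ x < 0]) _ _ h).
  have [je|je] := boolP (j \in verts e); first by apply: filterE => x /=; move=> /negP.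
  by apply: filterS (nbhs_bisect_lt (strict j je)) => x /=.
rewrite -tz in near.
have near' : nbhs t' (chart_pt c @^-1` _) := continuous_chart_pt near.
apply: filterS near' => s /= [Os hs].
have b12 := voronoi_chart_bisect s.
have half j : bisect (v e.1) (v j) (chart_pt c s) <= 0.
  have [je|je] := boolP (j \in verts e); last exact: ltW (hs j je).
  by move: je; rewrite !inE => /orP[] /eqP ->; rewrite ?b12 // bisectE subrr.
rewrite /voronoi_face !cellE; split; split=> // j.
by move: (half j) b12; rewrite !bisectE; lra.
Qed.

End VoronoiFace.

End Cells.

(** * Derivatives and integrals of affine fields *)

Section Derivatives.
Variable R : realType.
Local Notation vec := 'rV[R]_3.

Lemma derive_affine (f : vec -> R^o) (x w : vec) (c : R) :
  (forall h, f (h *: w + x) - f x = h * c) -> 'D_w f x = c.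
Proof.
move=> fc; rewrite /derive; apply: cvg_lim => //.
apply: (@cvg_trans _ ((fun=> c : R^o) @ (0 : R)^')); last exact: cvg_cst.
apply: near_eq_cvg; near=> h.
have h0 : h != 0 by near: h; exact: nbhs_dnbhs_neq.
by rewrite /= fc /GRing.scale /= mulKf.
Unshelve. all: by end_near.
Qed.

Lemma grad_affine (f : vec -> R^o) (a : R) (b x : vec) :
  (forall y, f y = a + dot b y) -> grad f x = b.
Proof.
move=> fE; apply/rowP => i; rewrite mxE; apply: derive_affine => h.
rewrite !fE !dotDE /dot (bigD1 i) //= big1 ?mxE ?eqxx ?mulr1 ?addr0; first ring.
by move=> j ji; rewrite mxE (negbTE ji) andbF mulr0.
Qed.

Lemma derive_coord_rot (f : vec -> vec) (a b x : vec) (i j : 'I_3) :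
  (forall y, f y = a + cross b y) ->
  'D_(delta_mx 0 j : vec) (fun y : vec => f y 0 i : R^o) x =
  cross b (delta_mx 0 j) 0 i.
Proof.
move=> fE; apply: derive_affine => h.
by rewrite !fE crossDr crossZr !vecDE vecZE; ring.
Qed.

Lemma curl_affine (f : vec -> vec) (a b x : vec) :
  (forall y, f y = a + cross b y) -> curl f x = 2 *: b.
Proof.
move=> fE; apply/rowP; apply: ord3P; rewrite mxE !(derive_coord_rot _ _ _ fE).
- have -> : (0 + 1 : 'I_3) = 1 by apply/val_inj.
  have -> : (0 + 2 : 'I_3) = 2%:R by apply/val_inj.
  by rewrite crossE1 crossE2 !mxE /=; ring.
- have -> : (1 + 1 : 'I_3) = 2%:R by apply/val_inj.
  have -> : (1 + 2 : 'I_3) = 0 by apply/val_inj.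
  by rewrite crossE0 crossE2 !mxE /=; ring.
have -> : (2%:R + 1 : 'I_3) = 0 by apply/val_inj.
have -> : (2%:R + 2 : 'I_3) = 1 by apply/val_inj.
by rewrite crossE0 crossE1 !mxE /=; ring.
Qed.

End Derivatives.

Section LineAndSurfaceIntegrals.
Variables (R : realType) (M : mesh R).
Hypothesis DV : delaunay_voronoi_mesh M.
Local Notation vec := 'rV[R]_3.
Local Notation mR := (measurableTypeR R).
Local Notation mu := (@lebesgue_measure R).
Local Notation vid := 'I_(nD M).
Local Notation tid := 'I_(nV M).
Local Notation v := (@vtx R M).
Implicit Types (i j : vid) (k l m : tid) (s T A : {set vid}) (x p q : vec)
  (e : vid * vid).

Lemma segment_hull e (t : R) : 0 <= t <= 1 ->
  hull (verts e) (v e.1 + t *: (v e.2 - v e.1)).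
Proof.
by move=> t01; apply: hull_convex => //; apply: hull_vtx; rewrite !inE eqxx ?orbT.
Qed.

Lemma edge_len_gt0 e : e.1 != e.2 -> 0 < edge_len e.
Proof. by move=> e12; rewrite /edge_len enorm_gt0 // edge_vec_neq0. Qed.

Lemma edge_avg_eq (g h : vec -> vec) e :
  (forall x, hull (verts e) x ->
    dot (g x) (v e.2 - v e.1) = dot (h x) (v e.2 - v e.1)) ->
  edge_avg g e = edge_avg h e.
Proof.
move=> gh; rewrite /edge_avg /line_int; congr (_ * (_ * _)).
apply: eq_Rintegral => t; rewrite inE /= in_itv /= => t01.
by rewrite /tangent !dotZr gh //; exact: segment_hull.
Qed.

Lemma edge_avg_cst (g : vec -> vec) e (r : R) : e.1 != e.2 ->
  (forall x, hull (verts e) x -> dot (g x) (v e.2 - v e.1) = r) ->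
  edge_avg g e = (edge_len e)^-1 * r.
Proof.
move=> e12 gr; have l0 := edge_len_gt0 e12.
rewrite /edge_avg /line_int -/(edge_len e) mulrA mulVf ?gt_eqF // mul1r.
rewrite (@eq_Rintegral _ _ _ _ _ (fun=> (edge_len e)^-1 * r)).
  rewrite Rintegral_cst; last exact: measurable_itv.
  have -> : fine (mu [set` `[0%R, 1%R]]) = 1.
    by rewrite lebesgue_measure_itv /= lte_fin ltr01 oppr0 adde0.
  by rewrite mulr1.
move=> t; rewrite inE /= in_itv /= => t01.
by rewrite /tangent dotZr gr //; exact: segment_hull.
Qed.

Lemma edge_avg_eq0 (g : vec -> vec) e :
  (forall x, hull (verts e) x -> dot (g x) (v e.2 - v e.1) = 0) ->
  edge_avg g e = 0.
Proof.
move=> g0; rewrite (@edge_avg_eq g (fun=> 0)).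
  rewrite /edge_avg /line_int; under eq_Rintegral do rewrite dot0l.
  by rewrite Rintegral_cst ?mul0r ?mulr0 //; exact: measurable_itv.
by move=> x /g0 ->; rewrite dot0l.
Qed.

Section Face.
Variables (s : {set vid}) (k : tid) (a b c : vid).
Hypotheses (sk : s \subset tet k) (sE : enum s = [:: a; b; c]).

Let N : vec := cross (v b - v a) (v c - v a).

Lemma mem_face i : (i \in s) = [|| i == a, i == b | i == c].
Proof. by rewrite -mem_enum sE !inE. Qed.

(** Sets of ordinals are enumerated in increasing order. *)
Lemma face_lt : [/\ (a < b)%N, (b < c)%N & (a < c)%N].
Proof.
have : sorted ltn (map val (enum s)).
  rewrite sorted_map /enum_mem -enumT; apply: sorted_filter.
    by move=> y x z; exact: ltn_trans.
  by rewrite -sorted_map val_enum_ord iota_ltn_sorted.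
rewrite sE /= => /and3P[ab bc _]; split=> //; exact: ltn_trans bc.
Qed.

Lemma face_chartE : face_chart s = (v a, v b - v a, v c - v a).
Proof. by rewrite /face_chart sE. Qed.

(** In the chart of a face, 1 - s - t, s and t are the barycentric coordinates. *)
Lemma face_chart_hull : chart_pt (face_chart s) @^-1` hull s =
  [set t : mR * mR | [/\ 0 <= t.1, 0 <= t.2 & t.1 + t.2 <= 1]].
Proof.
have [ab bc ac] := face_lt.
have [ks kb kc] : [/\ a \in tet k, b \in tet k & c \in tet k].
  by split; apply: (fintype.subsetP sk); rewrite mem_face eqxx ?orbT.
have E i t : bary k i (chart_pt (face_chart s) t) =
    (i == a)%:R * (1 - t.1 - t.2) + (i == b)%:R * t.1 + (i == c)%:R * t.2.
  rewrite face_chartE -(bary_vtx DV i ks) -(bary_vtx DV i kb) -(bary_vtx DV i kc).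
  by rewrite /bary dot_chart_pt /= !dotBr; ring.
have ba : (b == a) = false by apply/gtn_eqF.
have ca : (c == a) = false by apply/gtn_eqF.
have cb : (c == b) = false by apply/gtn_eqF.
apply/seteqP; split=> t /=.
  move=> /(hull_baryP DV _ sk)[h0 _].
  have := h0 a; have := h0 b; have := h0 c.
  rewrite !E !eqxx ba ca cb ![a == _]eq_sym [b == c]eq_sym ba ca cb /=.
  by split; lra.
move=> [t1 t2 t12]; apply/(hull_baryP DV _ sk); split=> i; rewrite E.
  have h : 0 <= 1 - t.1 - t.2 by lra.
  by rewrite !addr_ge0 // mulr_ge0 // ler0n.
rewrite mem_face !negb_or => /and3P[/negbTE-> /negbTE-> /negbTE->].
by rewrite !mul0r !addr0.
Qed.

Lemma face_areaE : face_area s = enorm N / 2.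
Proof.
rewrite /face_area areaE face_chart_hull triangle_area face_chartE /=.
by [].
Qed.

Lemma face_normal_neq0 : N != 0.
Proof.
have [ab bc ac] := face_lt.
have [ks kb kc] : [/\ a \in tet k, b \in tet k & c \in tet k].
  by split; apply: (fintype.subsetP sk); rewrite mem_face eqxx ?orbT.
have ba : (b == a) = false by apply/gtn_eqF.
have ca : (c == a) = false by apply/gtn_eqF.
have cb : (c == b) = false by apply/gtn_eqF.
apply/eqP => N0.
have u0 : v b - v a != 0.
  by rewrite subr_eq0; apply/eqP => /(vtx_inj DV)/eqP; rewrite ba.
have := cross_cross (v b - v a) (v b - v a) (v c - v a).
rewrite -/N N0 (_ : cross _ 0 = 0); last by apply: vec3P; rewrite !vecE; ring.
move=> /esym/eqP; rewrite subr_eq0 => /eqP E.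
have := congr1 (dot (bary_grad k c)) E; rewrite !dotZr !dotBr.
have := bary_vtx DV c ks; have := bary_vtx DV c kb; have := bary_vtx DV c kc.
rewrite eqxx ca cb /bary /= => hc hb ha.
have -> : dot (bary_grad k c) (v b) - dot (bary_grad k c) (v a) = 0 by lra.
have -> : dot (bary_grad k c) (v c) - dot (bary_grad k c) (v a) = 1 by lra.
by rewrite mulr0 mulr1 => /esym/eqP; rewrite -!dotBr dot_eq0 (negbTE u0).
Qed.

Lemma face_area_gt0 : 0 < face_area s.
Proof. by rewrite face_areaE divr_gt0 // enorm_gt0 // face_normal_neq0. Qed.

Lemma face_avg_eq (g h : vec -> vec) :
  (forall x, hull s x -> dot (g x) (fnormal s) = dot (h x) (fnormal s)) ->
  face_avg g s = face_avg h s.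
Proof.
move=> gh; rewrite /face_avg /surf_int; congr (_ * (_ * _)).
by apply: eq_Rintegral => t; rewrite inE /= => /gh.
Qed.

Lemma face_avg_cst (g : vec -> vec) (r : R) :
  (forall x, hull s x -> dot (g x) (fnormal s) = r) -> face_avg g s = r.
Proof.
move=> gr; rewrite /face_avg /surf_int.
rewrite (@eq_Rintegral _ _ _ (lebesgue2 R) _ (fun=> r)); last first.
  by move=> t; rewrite inE /= => /gr.
rewrite (@Rintegral_cst _ _ _ (lebesgue2 R)).
  rewrite -[X in _ * X = _]mulrCA.
  have -> : enorm (cross (face_chart s).1.2 (face_chart s).2) *
     fine (lebesgue2 R (chart_pt (face_chart s) @^-1` hull s)) = face_area s by [].
  by rewrite mulrCA mulVf ?mulr1 // gt_eqF // face_area_gt0.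
rewrite face_chart_hull; exact: triangle_measurable.
Qed.

End Face.

Lemma enum_face s : #|s| = 3%N -> exists a b c, enum s = [:: a; b; c].
Proof.
rewrite cardE; case: (enum s) => [|a [|b [|c [|]]]] // _.
by exists a, b, c.
Qed.

(** The segment from ccenter k to ccenter m leaves D_k at the common face. Beyond it
    is in D_m; if it were in D_k too, it would have two points in the plane of the
    face, and ccenter m would be in that plane. *)
Lemma length_in_D k m (t0 : R) : Defs.adjacent k m -> 0 <= t0 <= 1 ->
  hull (common k m) (ccenter k + t0 *: (ccenter m - ccenter k)) ->
  length_in (ccenter k) (ccenter m) (D k) = voronoi_edge_len k m * t0.
Proof.
move=> km /andP[t00 t01]; set p := _ + _ => hp; rewrite /length_in; congr (_ * _).
set S := [set _ | _].
suff -> : S = `[0, t0]%classic.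
  rewrite lebesgue_measure_itv /= lte_fin.
  case: ltP => t0p; first by rewrite oppr0 adde0.
  by apply/le_anti; rewrite t00 t0p.
have [ck cm] : D k (ccenter k) /\ D m (ccenter m).
  by split; exact: (interior_subset (ccenter_interior DV _)).
have [pk pm] : D k p /\ D m p.
  by split; apply: hull_subset hp; [exact: finset.subsetIl|exact: finset.subsetIr].
apply/seteqP; split=> t; rewrite /S /= in_itv /=.
  move=> [/andP[t0' t1'] Dt]; rewrite t0' /= leNgt; apply/negP => tt.
  have mk : m != k by rewrite eq_sym; exact: adjacent_neq km.
  have [i im ik] := tet_diff DV mk.
  have Dmt : D m (ccenter k + t *: (ccenter m - ccenter k)).
    have -> : ccenter k + t *: (ccenter m - ccenter k) =
        p + ((t - t0) / (1 - t0)) *: (ccenter m - p).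
      have -> : ccenter m - p = (1 - t0) *: (ccenter m - ccenter k).
        by rewrite /p scalerBl scale1r opprD addrA.
      rewrite scalerA divfK; last by lra.
      by rewrite /p -addrA -scalerDl [t0 + _]addrC subrK.
    apply: hull_convex => //; have h : 0 < 1 - t0 by lra.
    by rewrite divr_ge0 ?ler_pdivrMr // ?mul1r; lra.
  have := D_overlap DV Dmt Dt ik; have := D_overlap DV pm pk ik.
  have := bary_interior DV (ccenter_interior DV m) im.
  rewrite /p !bary_affine; set B := bary m i (ccenter m); set A := bary m i _.
  move=> B0 E0 Et.
  have : (t - t0) * (B - A) = 0 by lra.
  move=> /eqP; rewrite mulf_eq0 => /orP[/eqP|/eqP BA]; first by lra.
  by rewrite BA in E0; lra.
move=> /andP[t0' t1']; rewrite t0' (le_trans t1') //; split=> //.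
have [t0p|t0n] := ltP 0 t0; last first.
  by rewrite (_ : t = 0) ?scale0r ?addr0 //; apply/le_anti; rewrite t0' (le_trans t1').
have -> : ccenter k + t *: (ccenter m - ccenter k) =
    ccenter k + (t / t0) *: (p - ccenter k).
  by rewrite /p [ccenter k + _ - _]addrAC subrr add0r scalerA divfK // gt_eqF.
by apply: hull_convex => //; rewrite divr_ge0 ?ler_pdivrMr ?mul1r.
Qed.

End LineAndSurfaceIntegrals.

(** * Finite element matrices *)

Section FinMatrixAlgebra.
Variables (R : realType) (S T : finType).

Lemma mulmx_fdiagl (F : S -> R) (G : S -> T -> R) :
  fdiag F *m fmx G = fmx (fun s t => F s * G s t).
Proof. by apply/matrixP => i j; rewrite mul_diag_mx !mxE. Qed.

Lemma mulmx_fdiagr (F : T -> R) (G : S -> T -> R) :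
  fmx G *m fdiag F = fmx (fun s t => G s t * F t).
Proof. by apply/matrixP => i j; rewrite mul_mx_diag !mxE. Qed.

Lemma fdiag_unit (F : S -> R) : (forall s, F s != 0) -> fdiag F \in unitmx.
Proof.
move=> F0; rewrite unitmxE det_diag unitfE; apply/prodf_neq0 => i _.
by rewrite mxE.
Qed.

Lemma tr_fdiag (F : S -> R) : (fdiag F)^T = fdiag F.
Proof. exact: tr_diag_mx. Qed.

Lemma fdiagC (F G : S -> R) : fdiag F *m fdiag G = fdiag G *m fdiag F.
Proof. by rewrite /fdiag diag_mxC. Qed.

Lemma fmx_fdiag (F : S -> R) : fmx (fun s s' => F s * (s == s')%:R) = fdiag F.
Proof.
apply/matrixP => i j; rewrite !mxE (inj_eq enum_val_inj).
by case: eqP => [->|]; rewrite ?mulr1n ?mulr1 ?mulr0.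
Qed.

End FinMatrixAlgebra.

Section FiniteElements.
Variables (R : realType) (M : mesh R).
Hypothesis DV : delaunay_voronoi_mesh M.
Local Notation vec := 'rV[R]_3.
Local Notation vid := 'I_(nD M).
Local Notation tid := 'I_(nV M).
Local Notation v := (@vtx R M).
Implicit Types (i j : vid) (k l m : tid) (s T A : {set vid}) (x p q : vec)
  (e : vid * vid).

Lemma dof_vertex_Omega (a : dof_vertex M) : Omega M (v (val a)).
Proof. by apply: (Omega_vtx DV); apply/asboolP; exact: valP a. Qed.

Lemma dof_edge_spec (a : dof_edge M) : exists k : tid,
  [/\ edge_of (val a) k, (val a).1 != (val a).2, verts (val a) \subset tet k &
      ~ (hull (verts (val a)) `<=` bdry M)].
Proof.
have /andP[/existsP[k ak] /asboolP nb] := valP a; exists k; split=> //.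
  by case/andP: ak => lt _; rewrite -val_eqE neq_ltn lt.
by case/andP: ak.
Qed.

Lemma edge_of_neq e l : edge_of e l -> e.1 != e.2.
Proof. by case/andP => lt _; rewrite -val_eqE neq_ltn lt. Qed.

Lemma edge_ofE (a : dof_edge M) l : edge_of (val a) l = (verts (val a) \subset tet l).
Proof. by have [k [/andP[lt _] _ _ _]] := dof_edge_spec a; rewrite /edge_of lt. Qed.

Lemma dof_face_spec (f : dof_face M) :
  [/\ ((val f).1 < (val f).2)%N, Defs.adjacent (val f).1 (val f).2,
      fverts f \subset tet (val f).1 & ~ (hull (fverts f) `<=` bdry M)].
Proof.
have /and3P[lt adj /asboolP nb] := valP f; split=> //.
exact: finset.subsetIl.
Qed.

(** * Values of the degrees of freedom of the basis functions *)

(** At an interior vertex the value is the degree of freedom, which by continuity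
    may be taken from D_l; at a boundary vertex it is 0. *)
Lemma grad_basis_vtx (phi : dof_vertex M -> sfield M) b l i : grad_basis phi ->
  i \in tet l -> phi b l (v i) = (i == val b)%:R.
Proof.
move=> [Hphi eta] il; have [_ cont bd] := Hphi b.
have Dl : D l (v i) by exact: hull_vtx.
have [bi|nb] := pselect (bdry M (v i)).
  rewrite (bd l) //; case: eqP => // ib.
  by have := dof_vertex_Omega b; rewrite -ib => Oi; case: bi.
pose a : dof_vertex M := exist _ i (introT (asboolP _) nb).
have := eta a b; rewrite /eta_grad /=; case: pickP => [l' il'|/(_ l)]; last by rewrite il.
have Dl' : D l' (v i) by exact: hull_vtx.
by rewrite (cont l' l _ Dl' Dl).
Qed.

Lemma edge_avg_tangential (u : vfield M) e l m : H_curl u ->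
  edge_of e l -> edge_of e m -> edge_avg (u l) e = edge_avg (u m) e.
Proof.
move=> [_ cont _] /andP[_ el] /andP[_ em].
have sub : verts e \subset common l m by rewrite finset.subsetI el em.
apply: edge_avg_eq => x hx; apply/eqP; rewrite -subr_eq0 -dotBl; apply/eqP.
apply: cont; last exact: hull_subset hx.
  by apply: (fintype.subsetP sub); rewrite !inE eqxx orbT.
by apply: (fintype.subsetP sub); rewrite !inE eqxx.
Qed.

(** On an interior edge the average is the degree of freedom, since tangential
    traces are single-valued; on a boundary edge they vanish. *)
Lemma curl_basis_edge (phi : dof_edge M -> vfield M) b l e : curl_basis phi ->
  edge_of e l -> edge_avg (phi b l) e = (e == val b)%:R.
Proof.
move=> [Hphi eta] el; have [nb|nb] := boolP `[< ~ (hull (verts e) `<=` bdry M) >].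
  have ea : [exists k, edge_of e k] && `[< ~ (hull (verts e) `<=` bdry M) >].
    by rewrite nb andbT; apply/existsP; exists l.
  pose a : dof_edge M := exist _ e ea.
  have := eta a b; rewrite /eta_curl /=;
  case: pickP => [l' el'|/(_ l)]; last by rewrite el.
  by rewrite (edge_avg_tangential (Hphi b) el' el).
have bi : hull (verts e) `<=` bdry M by move: nb => /asboolP; apply: contra_notP.
have [_ _ bd] := Hphi b; rewrite edge_avg_eq0.
  case: eqP => // eb; have [k [_ _ _ nbb]] := dof_edge_spec b.
  by move: bi; rewrite eb.
move=> x; case/andP: el => _ el; apply: bd => //; by rewrite !inE eqxx ?orbT.
Qed.

Lemma commonC k m : common k m = common m k.
Proof. exact: finset.setIC. Qed.

Lemma adjacentC k m : Defs.adjacent k m = Defs.adjacent m k.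
Proof. by rewrite /Defs.adjacent commonC. Qed.

Lemma face_of_common k m : Defs.adjacent k m -> face_of (common k m) k.
Proof. by move=> km; rewrite /face_of [_ == _]km finset.subsetIl. Qed.

(** Degrees of freedom are indexed by the pairs (k, m) with k < m, hence at most
    one of the two terms on the right is not 0. *)
Lemma div_basis_face (phi : dof_face M -> vfield M) b k m : div_basis phi ->
  Defs.adjacent k m ->
  face_avg (phi b k) (common k m) = ((k, m) == val b)%:R + ((m, k) == val b)%:R.
Proof.
move=> [Hphi eta] km; have [_ cont bd] := Hphi b.
have [ltb _ _ nbb] := dof_face_spec b.
have fk := face_of_common km.
have nk : normal_to (common k m) (fnormal (common k m)) := fnormal_normal DV fk.
have [nb|nb] := boolP `[< ~ (hull (common k m) `<=` bdry M) >]; last first.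
  have bi : hull (common k m) `<=` bdry M by move: nb => /asboolP; apply: contra_notP.
  have [a [a' [c sE]]] := enum_face (eqP km : #|common k m| = 3%N).
  rewrite (face_avg_cst DV (finset.subsetIl _ _) sE (r := 0)); last first.
    by move=> x hx; exact: bd hx.
  case: eqP => [kmb|_]; first by move: nbb; rewrite /fverts -kmb.
  case: eqP => [kmb|_]; last by rewrite addr0.
  by move: nbb; rewrite /fverts -kmb commonC.
have := adjacent_neq DV km; rewrite -val_eqE neq_ltn => /orP[lt|lt].
  have fa : [&& (k < m)%N, Defs.adjacent k m & `[< ~ (hull (common k m) `<=` bdry M) >]].
    by rewrite lt km nb.
  pose a : dof_face M := exist _ (k, m) fa.
  have := eta a b; rewrite /eta_div /fverts /= => ->.
  have -> : ((m, k) == val b) = false.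
    by apply/eqP => E; move: ltb; rewrite -E /= ltnNge ltnW.
  by rewrite addr0.
have fa : [&& (m < k)%N, Defs.adjacent m k & `[< ~ (hull (common m k) `<=` bdry M) >]].
  by rewrite lt adjacentC km commonC nb.
pose a : dof_face M := exist _ (m, k) fa.
have := eta a b; rewrite /eta_div /fverts /= => E.
have -> : ((k, m) == val b) = false.
  by apply/eqP => E'; move: ltb; rewrite -E' /= ltnNge ltnW.
rewrite add0r -[RHS]E [in RHS]commonC; apply: face_avg_eq => x hx.
by apply/eqP; rewrite -subr_eq0 -dotBl; apply/eqP; exact: cont hx.
Qed.

(** * Discrete gradient and curl *)

Lemma edge_len_neq0 (a : dof_edge M) : edge_len (val a) != 0.
Proof.
have [k [_ a12 _ _]] := dof_edge_spec a.
by rewrite gt_eqF // (edge_len_gt0 DV).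
Qed.

Lemma face_area_neq0 (f : dof_face M) : face_area (fverts f) != 0.
Proof.
have [_ adj sub _] := dof_face_spec f.
have [a [b [c sE]]] := enum_face (eqP adj : #|fverts f| = 3%N).
by rewrite gt_eqF // (face_area_gt0 DV sub sE).
Qed.

Lemma DeD_unit : DeD M \in unitmx.
Proof. by apply: fdiag_unit => a; exact: edge_len_neq0. Qed.

Lemma DpD_unit : DpD M \in unitmx.
Proof. by apply: fdiag_unit => f; exact: face_area_neq0. Qed.

Lemma DeV_unit : DeV M \in unitmx.
Proof.
apply: fdiag_unit => f; have [_ adj _ _] := dof_face_spec f.
rewrite /voronoi_edge_len enorm_eq0 subr_eq0 (ccenter_neq DV) // eq_sym.
exact: adjacent_neq adj.
Qed.

Lemma DpV_unit : DpV M \in unitmx.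
Proof.
apply: fdiag_unit => a; have [k [_ a12 ak nb]] := dof_edge_spec a.
by rewrite gt_eqF // (voronoi_face_area_gt0 DV a12 nb ak).
Qed.

Lemma DV_unit : Defs.DV M \in unitmx.
Proof.
apply: fdiag_unit => a; rewrite gt_eqF // (volume_cell_gt0 DV) //.
exact: dof_vertex_Omega.
Qed.

Lemma GFE_E (phi : dof_vertex M -> sfield M) : grad_basis phi ->
  GFE phi = invmx (DeD M) *m Gmx M.
Proof.
move=> gb.
suff <- : DeD M *m GFE phi = Gmx M by rewrite mulKmx // DeD_unit.
rewrite /DeD /GFE /Gmx mulmx_fdiagl; apply/matrixP => i j; rewrite !mxE.
set a := enum_val i; set b := enum_val j; rewrite /eta_curl.
case: pickP => [l al|]; last first.
  by have [k [ak _ _ _]] := dof_edge_spec a => /(_ k); rewrite ak.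
have [Hphi _] := gb; have [lin _ _] := Hphi b; have [a0 [b0 ab]] := lin l.
have a12 := edge_of_neq al.
rewrite (edge_avg_cst DV (r := dot b0 (v (val a).2 - v (val a).1))) //; last first.
  by move=> x _; rewrite /broken_grad (grad_affine _ ab).
rewrite mulrA divff ?edge_len_neq0 // mul1r dotBr.
have al' : verts (val a) \subset tet l by rewrite -edge_ofE.
rewrite -(grad_basis_vtx b gb (l := l)); last first.
  by apply: (fintype.subsetP al'); rewrite !inE eqxx orbT.
rewrite -(grad_basis_vtx b gb (l := l)); last first.
  by apply: (fintype.subsetP al'); rewrite !inE eqxx.
by rewrite !ab; ring.
Qed.

(** Stokes' theorem on the triangle p, q, r for the field y |-> a0 + cross b0 y, with
    curl 2 b0: the tangential component along an edge is constant, and can be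
    taken at the first vertex of the edge. *)
Lemma triangle_stokes (a0 b0 p q r : vec) :
  dot b0 (cross (q - p) (r - p)) =
  dot (a0 + cross b0 p) (q - p) + dot (a0 + cross b0 q) (r - q)
  - dot (a0 + cross b0 p) (r - p).
Proof. by rewrite !vecE; ring. Qed.

Lemma hull_affine_cst s (b x : vec) (r : R) :
  (forall i, i \in s -> dot b (v i) = r) -> hull s x -> dot b x = r.
Proof.
move=> br [w [_ ws w1 ->]]; rewrite sum_vecE -[RHS]mul1r -w1 mulr_suml.
apply: eq_bigr => i _; have [is_|is_] := boolP (i \in s); first by rewrite br.
by rewrite ws // !mul0r.
Qed.

(** The boundary of a face runs through its increasing vertices a, b, c, along the
    edges ab and bc, and back against the direction of ac. *)
Lemma incidence_signE (f : dof_face M) e a b c : enum (fverts f) = [:: a; b; c] ->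
  (e.1 < e.2)%N ->
  incidence_sign f e =
  Num.sg (dot (fnormal (fverts f)) (cross (v b - v a) (v c - v a))) *
  (((a, b) == e)%:R + ((b, c) == e)%:R - ((a, c) == e)%:R).
Proof.
move=> sE e12; have [ab bc ac] := face_lt sE.
have neq i j : (i < j)%N -> (i == j) = false /\ (j == i) = false.
  by move=> ij; rewrite [j == i]eq_sym -val_eqE /= ltn_eqF.
have [ab1 ab2] := neq _ _ ab; have [ac1 ac2] := neq _ _ ac; have [bc1 bc2] := neq _ _ bc.
have neqs := (eqxx, (ab1, ab2, ac1, ac2, bc1, bc2)).
rewrite /incidence_sign; set n := fnormal _.
case: ifPn => [sub|nsub].
  rewrite (eq_bigl (fun i => (i \in fverts f) && (i \notin verts e))); last first.
    by move=> i; rewrite finset.in_setD andbC.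
  rewrite -big_enum_cond sE !big_cons big_nil.
  have : e.1 \in fverts f by apply: (fintype.subsetP sub); rewrite !inE eqxx.
  have : e.2 \in fverts f by apply: (fintype.subsetP sub); rewrite !inE eqxx orbT.
  move: e12; case: e sub => e1 e2 /= sub e12; rewrite !(mem_face sE).
  have abs i j : (i < j)%N -> (j < i)%N -> False.
    by move=> h1 h2; move: (ltn_trans h1 h2); rewrite ltnn.
  case/or3P => /eqP ?; case/or3P => /eqP ?; subst e1 e2;
    rewrite ?ltnn // in e12;
    try by [case: (abs _ _ ab e12)|case: (abs _ _ ac e12)
           |case: (abs _ _ bc e12)].
  - rewrite !(inE, xpair_eqE, neqs) /=.
    by rewrite !addr0 !subr0 mulr1.
  - rewrite !(inE, xpair_eqE, neqs) /=.
    rewrite crossC dotNr sgrN; ring.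
  - rewrite !(inE, xpair_eqE, neqs) /=.
    rewrite addr0 subr0 add0r mulr1; congr (Num.sg (dot n _)).
    by apply: vec3P; rewrite !vecE; ring.
have nin i j : i \in fverts f -> j \in fverts f -> ((i, j) == e) = false.
  move=> is_ js; apply/eqP => E; move: nsub; rewrite -E; case/negP.
  by apply/fintype.subsetP => x; rewrite finset.in_set2 => /orP[] /eqP ->.
have [sa sb sc] : [/\ a \in fverts f, b \in fverts f & c \in fverts f].
  by rewrite !(mem_face sE) !eqxx !orbT.
by rewrite !nin // addr0 subr0 mulr0.
Qed.

(** Up to the sign of dot n N, where N is twice the vector area of the face and n
    its chosen unit normal, the flux of the curl is the circulation of
    [triangle_stokes]; the edge averages of the basis function of e are 1 on e and
    0 on the other edges. *)
Lemma KFE_E (phi : dof_edge M -> vfield M) : curl_basis phi ->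
  KFE phi = invmx (DpD M) *m Kmx M *m DeD M.
Proof.
move=> cb.
suff E : DpD M *m KFE phi = Kmx M *m DeD M.
  by rewrite -mulmxA -E mulKmx // DpD_unit.
rewrite /DpD /KFE /Kmx /DeD mulmx_fdiagl mulmx_fdiagr.
apply/matrixP => i j; rewrite !mxE; set f := enum_val i; set e := enum_val j.
have [_ adj sub _] := dof_face_spec f; set l := (val f).1 in sub *.
have [a [b [c sE]]] := enum_face (eqP adj : #|fverts f| = 3%N).
have [ab bc ac] := face_lt sE.
have [Hphi _] := cb; have [lin _ _] := Hphi e; have [a0 [b0 abE]] := lin l.
set s := fverts f in sub sE *; set n := fnormal s.
have fs : face_of s l by rewrite /face_of sub andbT.
rewrite /eta_div -/l -/s (face_avg_cst DV sub sE (r := 2 * dot b0 n)); last first.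
  by move=> x _; rewrite /broken_curl (curl_affine _ abE) dotZl.
rewrite (face_areaE DV sub sE); set N := cross _ _.
pose ka := dot n N.
have n1 : dot n n = 1.
  by rewrite -enorm_sqr (fnormal_unit DV fs) expr1n.
have N0 : N != 0 := face_normal_neq0 DV sub sE.
have nN : n = (dot n N / dot N N) *: N.
  apply: orth2_colinear => //; apply: (fnormal_normal DV fs);
  by rewrite (mem_face sE) eqxx ?orbT.
have NN : dot N N != 0 by rewrite dot_eq0.
have kaN : ka ^+ 2 = dot N N.
  move: n1; rewrite {1 2}nN dotZl dotZr -/ka => h.
  apply: (mulIf (invr_neq0 NN)); by rewrite divff // -[RHS]h; field.
have Nn : N = ka *: n.
  by rewrite nN scalerA mulrA -expr2 kaN divff // scale1r.
have ka0 : ka != 0 by rewrite -sqrf_eq0 kaN.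
have Nka : enorm N = `|ka|.
  by rewrite Nn enormZ (fnormal_unit DV fs) mulr1.
have E i1 j1 : i1 \in s -> j1 \in s -> (i1 < j1)%N ->
    dot (a0 + cross b0 (v i1)) (v j1 - v i1) = edge_len (val e) * ((i1, j1) == val e)%:R.
  move=> i1s j1s ij.
  have el : edge_of (i1, j1) l.
    rewrite /edge_of ij; apply/fintype.subsetP => x; rewrite !inE => /orP[] /eqP ->;
    exact: (fintype.subsetP sub).
  have := curl_basis_edge e cb el.
  rewrite (edge_avg_cst DV (r := dot (a0 + cross b0 (v i1)) (v j1 - v i1))) //; first last.
  - move=> x hx; rewrite abE; set d := v j1 - v i1.
    have cE y : dot (a0 + cross b0 y) d = dot a0 d + dot (cross d b0) y.
      by rewrite !vecE; ring.
    rewrite !cE; congr (_ + _); apply: (hull_affine_cst _ hx) => y.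
    rewrite !inE => /orP[] /eqP -> //; apply/eqP; rewrite -subr_eq0 -dotBr.
    by rewrite -/d dot_crossl.
  - exact: edge_of_neq el.
  move=> h; have l0 := edge_len_gt0 DV (edge_of_neq el).
  have -> : dot (a0 + cross b0 (v i1)) (v j1 - v i1) =
     edge_len (i1, j1) * ((edge_len (i1, j1))^-1 * dot (a0 + cross b0 (v i1)) (v j1 - v i1)).
    by rewrite mulrA divff ?mul1r // gt_eqF.
  by rewrite h; case: eqP => [->|]; rewrite ?mulr0.
have [sa sb sc] : [/\ a \in s, b \in s & c \in s] by rewrite !(mem_face sE) !eqxx !orbT.
have St := triangle_stokes a0 b0 (v a) (v b) (v c).
rewrite -/N !E // in St.
have I : incidence_sign f (val e) = Num.sg ka *
   (((a, b) == val e)%:R + ((b, c) == val e)%:R - ((a, c) == val e)%:R).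
  by apply: (incidence_signE sE); have [k0 [/andP[]]] := dof_edge_spec e.
rewrite I Nka; move: St; rewrite Nn dotZr => St.
have {}St : dot b0 n = ka^-1 * edge_len (val e) *
   (((a, b) == val e)%:R + ((b, c) == val e)%:R - ((a, c) == val e)%:R).
  by apply: (mulfI ka0); rewrite St; field.
rewrite St [`|ka|]normrEsg; set br := _ - _; by field.
Qed.

(** * Lumped mass matrices *)

Lemma sum_delta (I : finType) (P : pred I) (A : I) (G : I -> R) :
  \sum_(i | P i) (i == A)%:R * G i = if P A then G A else 0.
Proof.
case: ifPn => PA.
  rewrite (bigD1 A) //= eqxx mul1r big1 ?addr0 // => i /andP[_ /negbTE ->].
  by rewrite mul0r.
rewrite big1 // => i Pi; case: eqP => [iA|]; last by rewrite mul0r.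
by move: PA; rewrite -iA Pi.
Qed.

Lemma Mp_E (phi : dof_vertex M -> sfield M) : grad_basis phi -> Mp phi = Defs.DV M.
Proof.
move=> gb; rewrite /Defs.DV -fmx_fdiag /Mp; apply/matrixP => i j; rewrite !mxE.
set a := enum_val i; set b := enum_val j.
rewrite (volume_cell DV (dof_vertex_Omega a)) mulr_suml [RHS]big_mkcond.
apply: eq_bigr => l _.
transitivity (\sum_(i in tet l) (i == val a)%:R *
   (volume (D l `&` cell i) * (a == b)%:R)).
  apply: eq_bigr => k kl; rewrite !(grad_basis_vtx _ gb kl).
  case: eqP => [->|]; last by rewrite !mulr0 !mul0r.
  by rewrite mul1r mulr1 (inj_eq val_inj).
exact: sum_delta.
Qed.

Lemma ME_E (phi : dof_edge M -> vfield M) : curl_basis phi ->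
  ME phi = DpV M *m DeD M.
Proof.
move=> cb; rewrite /DpV -[DeD M]fmx_fdiag mulmx_fdiagl /ME.
apply/matrixP => i j; rewrite !mxE; set a := enum_val i; set b := enum_val j.
have [k0 [_ a12 ak0 nb]] := dof_edge_spec a.
rewrite (voronoi_face_area_sum DV a12 nb ak0) mulr_suml [RHS]big_mkcond.
apply: eq_bigr => l _.
transitivity (\sum_(e | edge_of e l) (e == val a)%:R *
   (voronoi_face_area_in e (D l) * (edge_len e * (a == b)%:R))).
  apply: eq_bigr => e el; rewrite !(curl_basis_edge _ cb el).
  case: eqP => [->|]; last by rewrite !mulr0 !mul0r.
  by rewrite mul1r mulr1 (inj_eq val_inj) mulrA.
by rewrite sum_delta edge_ofE.
Qed.

Lemma length_in_sum k m : Defs.adjacent k m ->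
  length_in (ccenter k) (ccenter m) (D k) +
  length_in (ccenter m) (ccenter k) (D m) = voronoi_edge_len k m.
Proof.
move=> km; have [c [[t t01 tc] hc]] := voronoi_edge_meets DV km.
move: t01; rewrite /= in_itv /= => t01; rewrite -tc in hc.
rewrite (length_in_D DV km t01 hc).
rewrite (@length_in_D _ _ DV m k (1 - t)); first last.
- rewrite commonC (_ : _ + _ = ccenter k + t *: (ccenter m - ccenter k)) //.
  by apply: vec3P; rewrite !vecE; ring.
- by case/andP: t01 => t0 t1; rewrite subr_ge0 t1 lerBlDr lerDl.
- by rewrite adjacentC.
by rewrite /voronoi_edge_len enormBC; ring.
Qed.

(** The face of the index (k, m) is counted from D_k and from D_m, with the two parts
    into which it cuts its Voronoi edge. *)
Lemma MB_E (phi : dof_face M -> vfield M) : div_basis phi ->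
  MB phi = DpD M *m DeV M.
Proof.
move=> db; rewrite /DpD -[DeV M]fmx_fdiag mulmx_fdiagl /MB.
apply/matrixP => i j; rewrite !mxE; set a := enum_val i; set b := enum_val j.
pose F (p : tid * tid) : R :=
  length_in (ccenter p.1) (ccenter p.2) (D p.1) * face_area (common p.1 p.2).
pose swap (p : tid * tid) := (p.2, p.1).
have [ltb _ _ _] := dof_face_spec b; have [lta adja _ _] := dof_face_spec a.
have abE : (val a == val b) = (a == b) by exact: inj_eq val_inj _ _.
have dba := div_basis_face a db; have dbb := div_basis_face b db.
rewrite /fverts; move: (val a) (val b) lta adja ltb abE dba dbb => A B.
move=> ltA adjA ltB abE dba dbb.
have swI (p q : tid * tid) : (swap p == swap q) = (p == q).
  by case: p q => [p1 p2] [q1 q2]; rewrite !xpair_eqE andbC.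
have swN (p q : tid * tid) : (p.1 < p.2)%N -> (q.1 < q.2)%N -> (p == swap q) = false.
  by move=> + ltq; apply: contraTF => /eqP ->; rewrite -leqNgt ltnW.
rewrite /lump_B pair_big_dep /=.
transitivity (\sum_(p : tid * tid | Defs.adjacent p.1 p.2)
   ((p == A)%:R * (F p * (a == b)%:R) + (p == swap A)%:R * (F p * (a == b)%:R))).
  apply: eq_bigr => p adjp; rewrite (dba _ _ adjp) (dbb _ _ adjp) -/(F p).
  rewrite -[(p.1, p.2)]surjective_pairing -/(swap p) -abE.
  have sw (q : tid * tid) : (swap p == q) = (p == swap q) by case: q => q1 q2; rewrite -swI.
  rewrite !sw; have [->|_] := eqVneq p A; first by rewrite !swN //=; ring.
  have [->|_] := eqVneq p (swap A); last by rewrite addr0 mulr0 !mul0r addr0.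
  by rewrite swI [swap A == B]eq_sym swN //=; ring.
rewrite big_split /= !sum_delta /= [Defs.adjacent A.2 _]adjacentC adjA.
by rewrite /F /= [common A.2 _]commonC -(length_in_sum adjA); ring.
Qed.

End FiniteElements.

Local Close Scope classical_set_scope.

Theorem mainTheorem1 (R : realType) (M : mesh R)
    (phig : dof_vertex M -> sfield M) (phic : dof_edge M -> vfield M)
    (phid : dof_face M -> vfield M) (tau : R) :
  delaunay_voronoi_mesh M ->
  grad_basis phig -> curl_basis phic -> div_basis phid ->
  0 < tau ->
  A_SFE phig phic phid tau = A_MFD M tau.
Proof.
move=> MDV gb cb db _.
have uB : DpD M \in unitmx by exact: DpD_unit.
have uE : DeD M \in unitmx by exact: DeD_unit.
have uEV : DeV M \in unitmx by exact: DeV_unit.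
have uBV : DpV M \in unitmx by exact: DpV_unit.
have uV : Defs.DV M \in unitmx by exact: DV_unit.
have iB : invmx (DpD M) *m invmx (DeV M) *m MB phid = 1%:M.
  rewrite (MB_E MDV db) fdiagC -mulmxA mulKmx // mulVmx //.
have iE : invmx (DpV M) *m invmx (DeD M) *m ME phic = 1%:M.
  by rewrite (ME_E MDV cb) fdiagC -mulmxA mulKmx // mulVmx.
have iV : invmx (Defs.DV M) *m Mp phig = 1%:M by rewrite (Mp_E MDV gb) mulVmx.
have G := GFE_E MDV gb; have K := KFE_E MDV cb.
have KB : (KFE phic)^T *m MB phid = DeD M *m (Kmx M)^T *m DeV M.
  rewrite K (MB_E MDV db) !trmx_mul trmx_inv !tr_fdiag -!mulmxA.
  by rewrite mulKmx.
have GE : (GFE phig)^T *m ME phic = (Gmx M)^T *m DpV M.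
  rewrite G (ME_E MDV cb) trmx_mul trmx_inv tr_fdiag fdiagC -mulmxA mulKmx //.
rewrite /A_SFE /A_FE /A_MFD /block3.
rewrite col_mx0 row_mx0 !mulmx_block mul_block_col mul_mx_row.
rewrite !mulmx0 !mul0mx ?addr0 ?add0r.
rewrite -!scalemxAr iB iE iV !mulmxN mulmxA iB mul1mx.
rewrite row_mx0 addr0 mul_mx_row mulmx0 mulmxN GE KB.
rewrite [_ *m (ME _ *m _)]mulmxA iE mul1mx [_ *m (_ *m DpV M)]mulmxA -K -G.
by rewrite -[_ *m (DeD M *m _ *m _)]mulmxA -!(mulmxA (DeD M)) mulKmx // mulmxA.
Qed.
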